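(* D$_0$ graphs (regarded as signed, colored graphs) satisfy axioms 1, 2, 3, $4'a$ and LSP$_4$ and LSP$_5$. Hence a D$_0$ graph is a D graph if and only if it satisfies axioms $4'b$ and 5.
   Context: Words are in $\{1,\dots,N\}$; $\mathcal{W}_n$ is the set of words of length $n$ with no repeated letter. A D$_0$ graph of degree $n$ is a graph on $W\subseteq\mathcal{W}_n$ with edges colored from $\{2,\dots,n-1\}$ such that (i) each $i$-edge is one of $\{vbacw,vbcaw\}$, $\{vacbw,vcabw\}$, $\{vbacw,vacbw\}$, $\{vbcaw,vcabw\}$ for letters $a<b<c$ and words $v,w$ with $v$ of length $i-2$; (ii) for all such $a<b<c$, $v,w$, each element of $W\cap\{vbacw,vbcaw,vacbw,vcabw\}$ belongs to exactly one $i$-edge. It is regarded as a signed, colored graph with signature $\sigma(w)_i=+1$ if $w_i<w_{i+1}$, $-1$ otherwise. A signed, colored graph of degree $n$: a graph with vertex set $V$, edges colored from $\{2,\dots,n-1\}$, signature $\sigma:V\to\{\pm1\}^{n-1}$; generating function $\sum_{v}Q_{\{i:\sigma(v)_i=-1\}}(\mathbf{x})$ with $Q_S(\mathbf{x})=\sum x_{i_1}\cdots x_{i_n}$ over $1\le i_1\le\cdots\le i_n$, $i_j<i_{j+1}$ for $j\in S$. Axiom 0: each vertex lies on at most one $i$-edge for each $i$; then $E_i(v)=w$ means $\{v,w\}$ is an $i$-edge, $v$ admits an $i$-neighbor if such $w$ exists, and all expressions $E_{i_1}\cdots E_{i_r}(v)$ used must be defined. $\mathrm{Res}_K\mathcal{G}$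 for $K=\{i,\dots,j\}$: same vertices, signature $\hat\sigma(v)_s=\sigma(v)_{s+i-1}$ ($s\in[j-i]$), an $(s-i+1)$-edge for each $s$-edge with $i+1\le s\le j-1$; $\mathrm{Res}_K(\mathcal{G},w)$ its component containing $w$. LSP$_d$: every component of every $\mathrm{Res}_K\mathcal{G}$ with $|K|=d$ has Schur positive generating function. $v$ has $i$-type W if it admits an $i$- and an $(i-1)$-neighbor and $\sigma(v)_i=-\sigma(E_{i-1}(v))_i$. For $4\le i<n$, a flat $i$-chain is a sequence $(x^1,\dots,x^{2h})$ of distinct vertices admitting $(i-2)$-neighbors with $x^{2j-1}=E_i(x^{2j})$ and $x^{2j+1}=E_{i-2}(E_{i-1}E_{i-2})^{m_j}(x^{2j})$ for nonnegative integers $m_j$ with $(E_{i-1}E_{i-2})^{m_j}(x^{2j})$ not of $(i-1)$-type W. Axioms: (1) axiom 0 and $w$ admits an $i$-neighbor iff $\sigma(w)_{i-1}=-\sigma(w)_i$; (2) for each $i$-edge $\{w,x\}$, $\sigma(w)_j=-\sigma(x)_j$ for $j=i-1,i$ and $\sigma(w)_h=\sigma(x)_h$ for $h<i-2$, $h>i+1$; (3) for each $i$-edge $\{w,x\}$, if $\sigma(w)_{i-2}=-\sigma(x)_{i-2}$ then $\sigma(w)_{i-2}=-\sigma(w)_{i-1}$, and if $\sigma(w)_{i+1}=-\sigma(x)_{i+1}$ then $\sigma(w)_{i+1}=-\sigma(w)_i$; ($4'a$) for every $w$ admitting an $(i-1)$-neighbor $v$ with $\{w,v\}$ not an $i$-edge,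 $\sigma(w)_{i-3}\ne\sigma(v)_{i-3}$, $\sigma(w)_i\ne\sigma(v)_i$, the generating functions of $\mathrm{Res}_{[i-3,i]}(\mathcal{G},w)$ and $\mathrm{Res}_{[i-2,i+1]}(\mathcal{G},w)$ agree; ($4'b$) if $(x^1,\dots,x^{2h})$ is a flat $i$-chain and $x^j$ has $(i+1)$-type W for some $2<j<2h-1$, then all of $x^1,\dots,x^j$ or all of $x^j,\dots,x^{2h}$ have $(i+1)$-type W; (5) if $\{w,x\}$ is an $i$-edge and $\{x,y\}$ a $j$-edge with $|i-j|\ge3$, there is $v$ with $\{w,v\}$ a $j$-edge and $\{v,y\}$ an $i$-edge. A D graph is a signed, colored graph satisfying axioms 1, 2, 3, $4'a$, $4'b$, 5, LSP$_4$ and LSP$_5$. *)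

(* Defs.v *)
From HB Require Import structures.
From mathcomp Require Import all_boot all_order all_algebra.
From mathcomp Require Import mpoly.

Set Implicit Arguments.
Unset Strict Implicit.
Unset Printing Implicit Defensive.

Import GRing.Theory.
Local Open Scope ring_scope.

(* Homogeneous power series in x_1, x_2, ... are given by all their truncations
   x_{p+1} = x_{p+2} = ... = 0, i.e. by a polynomial in {mpoly int[p]} for each
   number p of variables.  An identity of such power series is the family of
   the corresponding identities for all p.  The variable x_k is 'X_(k-1). *)

(* Positions are numbered from 1 in S, and from 0 in the tuple t: the condition
   i_j < i_{j+1} for j in S concerns the entries j-1 and j of t. *)
Definition Qindex n p (S : pred nat) (t : n.-tuple 'I_p) : bool :=
  [forall j : 'I_n, forall k : 'I_n, (k == j.+1 :> nat) ==>
    (if S j.+1 then (tnth t j < tnth t k)%N else (tnth t j <= tnth t k)%N)].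

Definition fundamentalQ (n p : nat) (S : pred nat) : {mpoly int[p]} :=
  \sum_(t : n.-tuple 'I_p | Qindex S t) \prod_(j < n) 'X_(tnth t j).

Definition is_partition (la : seq nat) : bool :=
  sorted geq la && (0%N \notin la).

Definition cell (la : seq nat) : finType :=
  {rc : 'I_(size la) * 'I_(head 0%N la) | (rc.2 < nth 0%N la rc.1)%N}.

Definition semistandard (la : seq nat) p (T : {ffun cell la -> 'I_p}) : bool :=
  [forall c : cell la, forall d : cell la,
     (((val c).1 == (val d).1) && ((val c).2 <= (val d).2)%N
        ==> (T c <= T d)%N)
  && (((val c).2 == (val d).2) && ((val c).1 < (val d).1)%N
        ==> (T c < T d)%N)].

Definition schur (la : seq nat) (p : nat) : {mpoly int[p]} :=
  \sum_(T : {ffun cell la -> 'I_p} | semistandard T)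
     \prod_(c : cell la) 'X_(T c).

Definition schur_positive (f : forall p, {mpoly int[p]}) : Prop :=
  exists (P : seq (seq nat)) (coef : seq nat -> nat),
    all is_partition P /\
    forall p, f p = \sum_(la <- P) schur la p *+ coef la.

Record cgraph (n : nat) (V : finType) := CGraph {
  edge : nat -> rel V;
  edge_sym : forall i, ssrbool.symmetric (edge i);
  edge_irr : forall i, irreflexive (edge i);
  edge_color : forall i u v, edge i u v -> (1 < i < n)%N
}.

(* A sign is a boolean b standing for (-1) ^+ b, so that true is -1. *)
Record scgraph (n : nat) (V : finType) := SCGraph {
  scg_graph :> cgraph n V;
  signature : V -> n.-1.-tuple bool
}.

Section SignedColoredGraphs.
Variables (n : nat) (V : finType) (G : scgraph n V).
Implicit Types (u v w x y : V) (i j h : nat).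

(* The entry sigma(v)_i for 1 <= i <= n-1; the value elsewhere is a dummy. *)
Definition sg v i : bool := nth false (false :: signature G v) i.

Definition admits i v : bool := [exists w, edge G i v w].

(* E_i as a partial function; it is determined by the graph under axiom 0. *)
Definition Eop i v : option V := [pick w | edge G i v w].

Definition component w : {set V} :=
  [set x | connect [rel u v | [exists i : 'I_n, edge G i u v]] w x].

Definition genfun_on (A : {set V}) (p : nat) : {mpoly int[p]} :=
  \sum_(v in A) fundamentalQ n p (sg v).

Definition typeW i v : bool :=
  [&& admits i v, admits i.-1 v &
      if Eop i.-1 v is Some u then sg v i != sg u i else false].

(* (E_{i-1} E_{i-2})^m, acting from the right: E_{i-2} is applied first. *)
Definition Epow i (m : nat) v : option V :=
  iter m (fun o => obind (Eop i.-1) (obind (Eop (i - 2)) o)) (Some v).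

(* The chain is x 1, ..., x (2h); other values of x are irrelevant. *)
Definition flat_chain i h (x : nat -> V) : Prop :=
  [/\ (4 <= i < n)%N,
      {in [pred j | 1 <= j <= h.*2]%N &, injective x},
      forall j, (1 <= j <= h.*2)%N -> admits (i - 2) (x j),
      forall j, (1 <= j <= h)%N -> Eop i (x j.*2) = Some (x j.*2.-1) &
      forall j, (1 <= j < h)%N -> exists m y,
        [/\ Epow i m (x j.*2) = Some y, ~~ typeW i.-1 y &
            Eop (i - 2) y = Some (x j.*2.+1)]].

Definition axiom0 : Prop :=
  forall i v x y, edge G i v x -> edge G i v y -> x = y.

Definition axiom1 : Prop :=
  axiom0 /\
  forall i w, (1 < i < n)%N -> admits i w = (sg w i.-1 != sg w i).

Definition axiom2 : Prop :=
  forall i w x, edge G i w x ->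
    [/\ sg w i.-1 != sg x i.-1, sg w i != sg x i &
        forall h, (1 <= h < n)%N -> ((h < i - 2) || (i.+1 < h))%N ->
          sg w h = sg x h].

Definition axiom3 : Prop :=
  forall i w x, edge G i w x ->
    ((1 <= i - 2)%N -> sg w (i - 2) != sg x (i - 2) ->
       sg w (i - 2) != sg w i.-1) /\
    ((i.+1 < n)%N -> sg w i.+1 != sg x i.+1 -> sg w i.+1 != sg w i).

Definition axiom4'b : Prop :=
  forall i h (x : nat -> V), flat_chain i h x ->
  forall j, (2 < j)%N -> (j < h.*2.-1)%N -> typeW i.+1 (x j) ->
    (forall k, (1 <= k <= j)%N -> typeW i.+1 (x k)) \/
    (forall k, (j <= k <= h.*2)%N -> typeW i.+1 (x k)).

Definition axiom5 : Prop :=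
  forall i j w x y, (i + 3 <= j)%N || (j + 3 <= i)%N ->
    edge G i w x -> edge G j x y ->
    exists v, edge G j w v /\ edge G i v y.

Section Restriction.
(* K = {a, ..., b}, meaningful for 1 <= a <= b <= n *)
Variables (a b : nat).

Definition res_edge (t : nat) : rel V :=
  fun u v => (1 < t < (b - a).+1)%N && edge G (t + a - 1) u v.

Fact res_edge_sym t : ssrbool.symmetric (res_edge t).
Proof. by move=> u v; rewrite /res_edge edge_sym. Qed.

Fact res_edge_irr t : irreflexive (res_edge t).
Proof. by move=> u; rewrite /res_edge edge_irr andbF. Qed.

Fact res_edge_color t u v : res_edge t u v -> (1 < t < (b - a).+1)%N.
Proof. by case/andP. Qed.

(* The entry s : 'I_(b - a) of the tuple is the sign number s+1, that is
   sigma(v)_{(s+1)+a-1}. *)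
Definition Res : scgraph (b - a).+1 V :=
  SCGraph (CGraph res_edge_sym res_edge_irr res_edge_color)
          (fun v => mktuple (fun s : 'I_(b - a).+1.-1 => sg v (s + a)%N)).

End Restriction.

End SignedColoredGraphs.

Section GeneratingFunctionAxioms.
Variables (n : nat) (V : finType) (G : scgraph n V).

(* The generating function of Res_[a,b](G, w). *)
Definition res_genfun (a b : nat) (w : V) (p : nat) : {mpoly int[p]} :=
  genfun_on (Res G a b) (component (Res G a b) w) p.

(* LSP_d; an interval of size d is {a, ..., a+d-1}. *)
Definition LSP (d : nat) : Prop :=
  forall a, (1 <= a)%N -> (a + d - 1 <= n)%N ->
  forall w, schur_positive (res_genfun a (a + d - 1) w).

(* The bounds on i say that sigma_{i-3} and sigma_i exist. *)
Definition axiom4'a : Prop :=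
  forall i w v, (4 <= i < n)%N ->
    edge G i.-1 w v -> ~~ edge G i w v ->
    sg G w (i - 3) != sg G v (i - 3) -> sg G w i != sg G v i ->
    forall p, res_genfun (i - 3) i w p = res_genfun (i - 2) i.+1 w p.

Definition Dgraph : Prop :=
  [/\ axiom1 G, axiom2 G & axiom3 G] /\
  [/\ axiom4'a, axiom4'b G & axiom5 G] /\
  LSP 4 /\ LSP 5.

End GeneratingFunctionAxioms.

(* The letters 1, ..., N are represented by the elements 0, ..., N-1 of 'I_N. *)
Section D0Graphs.
Variables (n N : nat) (W : {set n.-tuple 'I_N}).

Definition wvertex : finType := {w : n.-tuple 'I_N | w \in W}.

Definition wseq (x : wvertex) : seq 'I_N := tval (val x).

Definition same_pair (T : Type) (x y p q : T) : Prop :=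
  (x = p /\ y = q) \/ (x = q /\ y = p).

Definition D0pair (i : nat) (x y : seq 'I_N) : Prop :=
  exists (a b c : 'I_N) (v w : seq 'I_N),
    [/\ (a < b)%N, (b < c)%N, size v = (i - 2)%N &
      [\/ same_pair x y (v ++ [:: b; a; c] ++ w) (v ++ [:: b; c; a] ++ w),
          same_pair x y (v ++ [:: a; c; b] ++ w) (v ++ [:: c; a; b] ++ w),
          same_pair x y (v ++ [:: b; a; c] ++ w) (v ++ [:: a; c; b] ++ w) |
          same_pair x y (v ++ [:: b; c; a] ++ w) (v ++ [:: c; a; b] ++ w)]].

Definition is_D0 (G : cgraph n wvertex) : Prop :=
  [/\ forall w : n.-tuple 'I_N, w \in W -> uniq w,
      forall i (x y : wvertex), edge G i x y -> D0pair i (wseq x) (wseq y) &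
      forall i (a b c : 'I_N) (v w : seq 'I_N) (x : wvertex),
        (1 < i < n)%N -> (a < b)%N -> (b < c)%N -> size v = (i - 2)%N ->
        wseq x \in [:: v ++ [:: b; a; c] ++ w; v ++ [:: b; c; a] ++ w;
                       v ++ [:: a; c; b] ++ w; v ++ [:: c; a; b] ++ w] ->
        exists! y, edge G i x y].

(* The entry i : 'I_n.-1 of the tuple is the sign number i+1, which compares
   the letters w_{i+1} and w_{i+2}, i.e. the entries i and i+1 of the tuple w. *)
Definition word_signature (x : wvertex) : n.-1.-tuple bool :=
  let w := map val (wseq x) in
  mktuple (fun i : 'I_n.-1 => ~~ (nth 0%N w i < nth 0%N w i.+1)%N).

Definition D0_scgraph (G : cgraph n wvertex) : scgraph n wvertex :=
  SCGraph G word_signature.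

End D0Graphs.

(* Main.v *)
Require Import Defs.
From mathcomp Require Import all_boot all_order all_algebra.
From mathcomp Require Import mpoly.
From mathcomp Require Import zify.

Set Implicit Arguments.
Unset Strict Implicit.
Unset Printing Implicit Defensive.

(* Inside a window of m+1 positions, a component is recorded by the number
   g(s) of its vertices whose window is order isomorphic to s.  Perfect
   matchings of the 4-cycles bac - bca - cab - acb - bac force
   g(bac) + g(cab) = g(bca) + g(acb).  Modulo these linear relations, the
   coefficient of a Schur function in sum_s g(s) Q_Des(s) is, in degrees 4 and
   5, the sum of g over an explicit set of words, hence nonnegative: this is
   LSP_4 and LSP_5.  Each Schur function is expanded in fundamental
   quasisymmetric functions by standardizing its semistandard tableaux.
   For axiom 4'a, both components are paths with five vertices which carry the
   same signatures. *)

(** * Edges and signatures *)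

(** The graph is not determined by [W]: a 4-cycle lying in [W] has two perfect matchings, so the
    components of a window cannot be listed once and for all. The linear relations forget which
    matching was chosen. They come from double counting: the edges of one color join the vertices
    counted by g(bac) + g(cab) to those counted by g(bca) + g(acb), and a component is closed under
    them. A finite table then covers every D0 graph. The size of the table is forced: g = 1
    satisfies all relations and gives the n-th power of x_1 + x_2 + ..., so each shape receives as
    many words as it has standard tableaux. For a hook they are all the words whose descents fill
    the last positions, since only that hook has a standard tableau with this descent set, and it
    has just one. The choice is not evident only for (2,2), (3,2) and (2,2,1). The same
    indeterminacy shapes axiom 4'a: a vertex of the paths may have two candidate words, and the
    point is that both carry the same signs. *)

(* The neighbours of xyz in the 4-cycle bac - bca - cab - acb - bac, which
   depend on where the middle letter b stands. *)
Definition nb3 (x y z : nat) : seq (seq nat) :=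
  if (y < x < z) || (z < x < y) then [:: [:: x; z; y]; [:: y; z; x]]
  else if (x < z < y) || (y < z < x) then [:: [:: y; x; z]; [:: z; x; y]]
  else [::].

Definition nbrs (k : nat) (s : seq nat) : seq (seq nat) :=
  [seq take k s ++ t ++ drop k.+3 s
     | t <- nb3 (nth 0 s k) (nth 0 s k.+1) (nth 0 s k.+2)].

Lemma nbrs_cat v x y z w :
  nbrs (size v) (v ++ x :: y :: z :: w) = [seq v ++ t ++ w | t <- nb3 x y z].
Proof.
have E j :
    nth 0 (v ++ x :: y :: z :: w) (size v + j) = nth 0 [:: x, y, z & w] j.
  by rewrite nth_cat ltnNge leq_addr /= addKn.
rewrite /nbrs take_size_cat // -add3n -drop_drop drop_size_cat //= drop0.
by rewrite -addn2 -addn1 !E -[in nth _ _ (size v)](addn0 (size v)) E.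
Qed.

Lemma mem_nbrs v x y z x' y' z' w : [:: x'; y'; z'] \in nb3 x y z ->
  v ++ x' :: y' :: z' :: w \in nbrs (size v) (v ++ x :: y :: z :: w).
Proof.
move=> nb; rewrite nbrs_cat.
exact: (map_f (fun t => v ++ t ++ w) nb).
Qed.

Lemma size_nb3 t x y z : t \in nb3 x y z -> size t = 3.
Proof.
by rewrite /nb3; case: ifP => _; [|case: ifP => _];
   rewrite ?inE // => /orP[]/eqP->.
Qed.

Lemma split3 T (s : seq T) k : k.+2 < size s ->
  exists x y z, s = take k s ++ x :: y :: z :: drop k.+3 s.
Proof.
move=> lt_k; have: 2 < size (drop k s) by rewrite size_drop; lia.
rewrite -[X in exists x, exists y, exists z, X = _](cat_take_drop k).
rewrite -(add3n k) -drop_drop.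
case: (drop k s) => [|x [|y [|z w]]] //= _; exists x, y, z.
by rewrite drop0.
Qed.

Lemma nth_nbrs k s t : k.+2 < size s -> t \in nbrs k s ->
  [/\ size t = size s,
      [:: nth 0 t k; nth 0 t k.+1; nth 0 t k.+2]
        \in nb3 (nth 0 s k) (nth 0 s k.+1) (nth 0 s k.+2) &
      forall j, (j < k) || (k.+2 < j) -> nth 0 t j = nth 0 s j].
Proof.
move=> lt_k; have [x [y [z Es]]] := split3 lt_k.
have sz_v : size (take k s) = k by rewrite size_takel //; lia.
move: (take k s) (drop _ s) sz_v Es => v w sz_v ->; rewrite -{1}sz_v nbrs_cat.
case/mapP=> u u_nb ->; have /= := size_nb3 u_nb.
case: u u_nb => [|x' [|y' [|z' []]]] //= u_nb _.
rewrite !size_cat /= sz_v; split=> //.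
  rewrite !nth_cat sz_v ltnn !ltnNge leqnSn (leq_trans (leqnSn _) (leqnSn _)).
  by rewrite /= subnn subSnn (_ : k.+2 - k = 2) //; lia.
move=> j; rewrite !nth_cat sz_v => lt_j; case: ifP => //= ge_j.
by have -> : j - k = (j - k - 3).+3 by lia.
Qed.

Section D0.

Variables (n N : nat) (W : {set n.-tuple 'I_N}) (G : cgraph n (wvertex W)).
Hypothesis hG : is_D0 G.
Implicit Types (x y : wvertex W) (i : nat).

Definition letters x : seq nat := map (@nat_of_ord N) (wseq x).

Lemma size_letters x : size (letters x) = n.
Proof. by rewrite size_map size_tuple. Qed.

Lemma uniq_letters x : uniq (letters x).
Proof.
have [uniqW _ _] := hG; rewrite map_inj_uniq; last exact: val_inj.
exact/uniqW/(valP x).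
Qed.

Lemma letters_inj : injective letters.
Proof. by move=> x y /(inj_map val_inj) eq_xy; apply/val_inj/val_inj. Qed.

Lemma edge_nbrs i x y : edge G i x y -> letters y \in nbrs (i - 2) (letters x).
Proof.
have [_ pairG _] := hG; case/pairG => a [b [c [v [w [lt_ab lt_bc <- pairs]]]]].
rewrite /letters -(size_map (@nat_of_ord N) v).
by case: pairs; case=> -[-> ->];
   rewrite !map_cat mem_nbrs // /nb3;
   (case: ifP; [|case: ifP]); rewrite /= ?inE ?eqxx ?orbT //; lia.
Qed.

(** Each test in [nb3] fixes the relative order of the three letters, hence the triple a < b < c
    with which the last clause of [is_D0] is applied. *)
Lemma nbrs_edge i x : 1 < i < n -> nbrs (i - 2) (letters x) != [::] ->
  exists! y, edge G i x y.
Proof.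
have [_ _ exG] := hG => lt_i.
have lt_k : (i - 2).+2 < size (wseq x) by rewrite size_tuple; lia.
have [p [q [r Ex]]] := split3 lt_k.
have sz_v : size (take (i - 2) (wseq x)) = i - 2 by rewrite size_takel //; lia.
move: (take _ _) (drop _ _) sz_v Ex => v w sz_v Ex.
rewrite /letters Ex map_cat -{1}sz_v -(size_map (@nat_of_ord N) v).
rewrite nbrs_cat /nb3 /=.
case: ifP => [/orP[]/andP[lt1 lt2] _|_];
  last case: ifP => [/orP[]/andP[lt1 lt2] _|] //.
- by apply: (exG i q p r v w) => //; rewrite Ex !inE eqxx ?orbT.
- by apply: (exG i r p q v w) => //; rewrite Ex !inE eqxx ?orbT.
- by apply: (exG i p r q v w) => //; rewrite Ex !inE eqxx ?orbT.
- by apply: (exG i q r p v w) => //; rewrite Ex !inE eqxx ?orbT.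
Qed.

Lemma edge_uniq i x y z : edge G i x y -> edge G i x z -> y = z.
Proof.
move=> xy xz; have lt_i := edge_color xy.
have [|t [_ tP]] := nbrs_edge (x := x) lt_i; last by rewrite -(tP y) ?(tP z).
by have := edge_nbrs xy; case: nbrs.
Qed.

Definition letter x (j : nat) := nth 0 (letters x) j.

Lemma edge_letters i x y : edge G i x y ->
  [:: letter y (i - 2); letter y i.-1; letter y i]
    \in nb3 (letter x (i - 2)) (letter x i.-1) (letter x i) /\
  forall j, (j < i - 2) || (i < j) -> letter y j = letter x j.
Proof.
move=> xy; have /andP[lt_1i lt_in] := edge_color xy.
have E1 : (i - 2).+1 = i.-1 by lia.
have E2 : (i - 2).+2 = i by lia.
have := nth_nbrs _ (edge_nbrs xy).
by rewrite size_letters E2 E1 => /(_ lt_in)[].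
Qed.

Lemma sgE x i : 1 <= i < n ->
  sg (D0_scgraph G) x i = (letter x i <= letter x i.-1).
Proof.
case: i => // i lt_i; have lt_i' : i < n.-1 by lia.
by rewrite leqNgt; apply: (nth_mktuple _ false (Ordinal lt_i')).
Qed.

Lemma letter_neq x i j : i < n -> j < n -> i != j -> letter x i != letter x j.
Proof. by move=> lt_i lt_j; rewrite nth_uniq ?size_letters ?uniq_letters. Qed.

(** For three distinct letters, the median stands first or last exactly when the letter in the
    middle is a peak or a valley, that is, when the two signs differ. *)
Lemma admits_sg i x : 1 < i < n ->
  admits (D0_scgraph G) i x
    = (sg (D0_scgraph G) x i.-1 != sg (D0_scgraph G) x i).
Proof.
move=> lt_i; rewrite !sgE; try lia.
have neq j k : j < n -> k < n -> j != k -> _ := @letter_neq x j k.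
have := neq (i - 2) i.-1; have := neq i.-1 i; have := neq (i - 2) i.
rewrite (_ : i.-1.-1 = i - 2); last lia.
move=> /(_ ltac:(lia) ltac:(lia) ltac:(lia)) neq1.
move=> /(_ ltac:(lia) ltac:(lia) ltac:(lia)) neq2.
move=> /(_ ltac:(lia) ltac:(lia) ltac:(lia)) neq3.
apply/existsP/idP => [[y /edge_letters [+ _]]|sg_x].
  by rewrite /nb3; case: ifP => [? _|_]; [lia | case: ifP => [? _|//]; lia].
have [|y [xy _]] := nbrs_edge (x := x) lt_i; last by exists y.
have E1 : (i - 2).+1 = i.-1 by lia.
have E2 : (i - 2).+2 = i by lia.
rewrite /nbrs E2 E1 -!/(letter x _) /nb3.
by case: ifP => // mid1; case: ifP => // mid2; lia.
Qed.

Lemma D0_axiom1 : axiom1 (D0_scgraph G).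
Proof. by split=> [i v x y|i w lt_i]; [apply: edge_uniq | apply: admits_sg]. Qed.

Ltac nb3_cases :=
  rewrite /nb3; case: ifP => [?|_]; [|case: ifP => [?|//]];
  rewrite !inE !eqseq_cons !eqxx !andbT => /orP[]/and3P[/eqP? /eqP? /eqP?].

Lemma D0_axiom2 : axiom2 (D0_scgraph G).
Proof.
move=> i w x wx; have /andP[lt_1i lt_in] := edge_color wx.
have [nb out] := edge_letters wx; split; first 2 last.
- move=> h lt_h out_h; rewrite !sgE; try lia.
  by rewrite !out //; lia.
- rewrite !sgE; try lia; rewrite (_ : i.-1.-1 = i - 2); last lia.
  by move: nb; nb3_cases; lia.
- by rewrite !sgE; try lia; move: nb; nb3_cases; lia.
Qed.

(** If an edge changes the first of the three letters, it moves it in the direction of the second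
    one: down before a descent, up before an ascent. A neighbouring sign can only flip accordingly.
    The last letter behaves symmetrically. *)
Lemma D0_axiom3 : axiom3 (D0_scgraph G).
Proof.
move=> i w x wx; have /andP[lt_1i lt_in] := edge_color wx.
have [nb out] := edge_letters wx; split=> lt_i; rewrite !sgE; try lia.
- rewrite (_ : i.-1.-1 = i - 2); last lia.
  by rewrite (out (i - 2).-1); [move: nb; nb3_cases; lia | lia].
- rewrite (out i.+1) /=; last lia.
  by move: nb; nb3_cases; lia.
Qed.

End D0.

(** * Fundamental expansion of Schur functions *)

Definition perms n := permutations (iota 0 n).

Definition descents (s : seq nat) : seq bool :=
  [seq nth 0 s i.+1 <= nth 0 s i | i <- iota 0 (size s).-1].

(** The dummy head makes positions start from 1, as in [sg]. *)
Definition Qdes n p (D : seq bool) := fundamentalQ n p (nth false (false :: D)).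

Lemma nth_descents s i : i.+1 < size s ->
  nth false (false :: descents s) i.+1 = (nth 0 s i.+1 <= nth 0 s i).
Proof.
by move=> lt_i; rewrite /= (nth_map 0) ?nth_iota ?size_iota //; lia.
Qed.

Lemma mem_perms n s : (s \in perms n) = perm_eq s (iota 0 n).
Proof. exact: mem_permutations. Qed.

(** * Standardization and P-partitions *)

Section Standardization.

Variable v : nat -> nat.

Definition std_le i j := (v i < v j) || ((v i == v j) && (i <= j)).

Lemma std_le_total : total std_le.
Proof. by move=> i j; rewrite /std_le; lia. Qed.

Lemma std_le_trans : transitive std_le.
Proof. by move=> j i k; rewrite /std_le; lia. Qed.

Lemma std_le_anti : antisymmetric std_le.
Proof. by move=> i j; rewrite /std_le; lia. Qed.

Lemma std_le_refl : reflexive std_le.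
Proof. by move=> i; rewrite /std_le; lia. Qed.

(** This lists the positions by increasing value, ties from left to right: it is the inverse of the
    usual standardization, whose value at [i] is [index i (standardize n)]. *)
Definition standardize n := sort std_le (iota 0 n).

Lemma standardize_perms n : standardize n \in perms n.
Proof. by rewrite mem_perms perm_sort. Qed.

Lemma standardizeP n (s : seq nat) : s \in perms n ->
  (standardize n == s) = sorted std_le s.
Proof.
rewrite mem_perms => eq_s; apply/eqP/idP => [<-|sort_s].
  exact: (sort_sorted std_le_total).
apply: (sorted_eq std_le_trans std_le_anti) => //.
  exact: (sort_sorted std_le_total).
by rewrite perm_sort perm_sym.
Qed.

Lemma index_standardize n : {in gtn n &, forall i j,
  (index i (standardize n) <= index j (standardize n)) = std_le i j}.
Proof.
move=> i j lt_i lt_j; set s := standardize n.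
have sort_s : sorted std_le s := sort_sorted std_le_total _.
have mem_s k : k < n -> k \in s by rewrite mem_sort mem_iota.
have impl k l : k < n -> l < n -> index k s <= index l s -> std_le k l.
  move=> lt_k lt_l; apply: (sorted_leq_index std_le_trans std_le_refl sort_s);
  exact: mem_s.
apply/idP/idP; first exact: impl.
move=> le_ij; rewrite leqNgt; apply/negP => lt_ji.
have le_ji := impl _ _ lt_j lt_i (ltnW lt_ji).
have Eij : i = j by apply: std_le_anti; rewrite le_ij.
by rewrite Eij ltnn in lt_ji.
Qed.

End Standardization.

Definition lin_ext n (con : rel nat) (s : seq nat) :=
  all (fun i => all (fun j => con i j ==> (index i s <= index j s))
                    (iota 0 n)) (iota 0 n).

Section PPartitions.

Variables (n p : nat).
Local Notation tup := (n.+1.-tuple 'I_p).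

Definition tval_at (t : tup) (i : nat) : nat := tnth t (inord i).

Definition respects (con : rel nat) (t : tup) :=
  [forall i : 'I_n.+1, forall j : 'I_n.+1,
     con i j ==> std_le (tval_at t) i j].

Lemma respectsE con t :
  respects con t = lin_ext n.+1 con (standardize (tval_at t) n.+1).
Proof.
apply/forallP/allP => [resp i|lin].
  rewrite mem_iota => /andP[_ lt_i]; apply/allP => j.
  rewrite mem_iota => /andP[_ lt_j]; apply/implyP => con_ij.
  rewrite index_standardize //.
  by have /forallP/(_ (Ordinal lt_j))/implyP := resp (Ordinal lt_i); apply.
move=> i; apply/forallP => j; apply/implyP => con_ij.
have /lin/allP/(_ (j : nat)) : (i : nat) \in iota 0 n.+1.
  by rewrite mem_iota add0n ltn_ord.
rewrite mem_iota add0n ltn_ord => /(_ isT).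
by rewrite con_ij index_standardize //= ?inE.
Qed.

Local Open Scope ring_scope.

(** Read along [s], such a tuple is weakly increasing, and strictly so at the descents of [s], where
    a tie would have been broken the other way. These are the conditions that define [Qdes]. *)
Lemma sum_standardize (s : seq nat) : s \in perms n.+1 ->
  \sum_(t : tup | standardize (tval_at t) n.+1 == s)
     \prod_(j < n.+1) 'X_(tnth t j) = Qdes n.+1 p (descents s) :> {mpoly int[p]}.
Proof.
move=> perm_s; have eq_s : perm_eq s (iota 0 n.+1) by rewrite -mem_perms.
have sz_s : size s = n.+1 by rewrite (perm_size eq_s) size_iota.
have uniq_s : uniq s by rewrite (perm_uniq eq_s) iota_uniq.
have mem_s i : (i \in s) = (i < n.+1)%N by rewrite (perm_mem eq_s) mem_iota.
pose a (i : 'I_n.+1) : 'I_n.+1 := inord (index (i : nat) s).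
pose b (j : 'I_n.+1) : 'I_n.+1 := inord (nth 0%N s j).
have lt_nth j : (j < n.+1)%N -> (nth 0%N s j < n.+1)%N.
  by move=> lt_j; rewrite -mem_s mem_nth ?sz_s.
have lt_index (i : 'I_n.+1) : (index (i : nat) s < n.+1)%N.
  by rewrite -[X in (_ < X)%N]sz_s index_mem mem_s.
have aK : cancel a b.
  move=> i; apply/val_inj.
  by rewrite /a /b /= (inordK (lt_index i)) nth_index ?mem_s ?inordK.
have bK : cancel b a.
  by move=> j; apply/val_inj; rewrite /a /b /= !inordK ?index_uniq ?sz_s ?lt_nth.
pose h (u : tup) : tup := mktuple (fun i => tnth u (a i)).
pose h' (t : tup) : tup := mktuple (fun j => tnth t (b j)).
have hK : cancel h h'.
  by move=> u; apply: eq_from_tnth => j; rewrite !tnth_mktuple bK.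
have h'K : cancel h' h.
  by move=> u; apply: eq_from_tnth => j; rewrite !tnth_mktuple aK.
rewrite (reindex h); last by apply: onW_bij; exists h'.
apply: eq_big => [u|u _]; last first.
  rewrite [RHS](reindex_inj (can_inj aK)).
  by apply: eq_bigr => j _; rewrite tnth_mktuple.
rewrite standardizeP //.
(* [h u] puts the entry [j] of [u] at the place [s_j], so reading [h u] along [s] gives back [u]. *)
have val_h j : (j < n.+1)%N ->
    tval_at (h u) (nth 0%N s j) = @tnth n.+1 'I_p u (inord j).
  move=> lt_j; rewrite /tval_at tnth_mktuple; congr (nat_of_ord (tnth u _)).
  have -> : inord (nth 0%N s j) = b (inord j) by rewrite /b inordK.
  by rewrite bK.
apply/(sortedP 0%N)/forallP => [sort_s j|Q_u j].
  apply/forallP => k; apply/implyP => /eqP Ek.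
  have lt_j : (j.+1 < size s)%N by rewrite sz_s -Ek.
  rewrite nth_descents //; have := sort_s j lt_j.
  have : nth 0%N s j != nth 0%N s j.+1 by rewrite nth_uniq // ?(ltnW lt_j) //; lia.
  rewrite -Ek /std_le !val_h // !inord_val.
  by case: ifP; lia.
rewrite sz_s => lt_j; rewrite /std_le !val_h // ?(ltnW lt_j) //.
have := Q_u (inord j) => /forallP/(_ (inord j.+1)).
rewrite !inordK ?(ltnW lt_j) // eqxx nth_descents ?sz_s //=.
have : nth 0%N s j != nth 0%N s j.+1 by rewrite nth_uniq ?sz_s //; lia.
by case: ifP; lia.
Qed.

(* Stanley's decomposition of P-partitions into fundamental
   quasisymmetric functions of the linear extensions. *)
Lemma sum_respects con :
  \sum_(t : tup | respects con t) \prod_(j < n.+1) 'X_(tnth t j)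
  = \sum_(s <- perms n.+1 | lin_ext n.+1 con s) Qdes n.+1 p (descents s)
  :> {mpoly int[p]}.
Proof.
transitivity (\sum_(t : tup) \sum_(s <- perms n.+1 |
    lin_ext n.+1 con s && (standardize (tval_at t) n.+1 == s))
    \prod_(j < n.+1) 'X_(tnth t j) : {mpoly int[p]}).
  rewrite big_mkcond; apply: eq_bigr => t _; rewrite respectsE.
  rewrite (eq_bigl (fun s => (s == standardize (tval_at t) n.+1)
    && lin_ext n.+1 con (standardize (tval_at t) n.+1))) => [|s]; last first.
    by rewrite [s == _]eq_sym andbC; case: eqP => // ->.
  case: ifP => lin; last by rewrite big_pred0 // => s; rewrite andbF.
  under eq_bigl do rewrite andbT.
  by rewrite -big_filter filter_pred1_uniq ?big_seq1 ?permutations_uniq //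
             standardize_perms.
under eq_bigr do rewrite big_mkcondr.
rewrite exchange_big big_seq_cond [RHS]big_seq_cond.
apply: eq_bigr => s /andP[perm_s _].
by rewrite -(sum_standardize perm_s) [RHS]big_mkcond.
Qed.

End PPartitions.

Section Schur.

Variables (la : seq nat) (lab : seq (nat * nat)).

Definition row_le i j :=
  let: (c, d) := (nth (0, 0) lab i, nth (0, 0) lab j) in
  (c.1 == d.1) && (c.2 <= d.2).

Definition col_lt i j :=
  let: (c, d) := (nth (0, 0) lab i, nth (0, 0) lab j) in
  (c.2 == d.2) && (c.1 < d.1).

Definition cell_con i j := row_le i j || col_lt i j.

(* With such labels, a filling is semistandard iff its standardization is a
   linear extension of cell_con. *)
Definition labelling : bool :=
  [&& uniq lab,
      all (fun rc => [&& rc.1 < size la, rc.2 < head 0 la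
                       & rc.2 < nth 0 la rc.1]) lab,
      all (fun r => all (fun c => (r, c) \in lab) (iota 0 (nth 0 la r)))
          (iota 0 (size la)) &
      all (fun i => all (fun j => (row_le i j ==> (i <= j))
                               && (col_lt i j ==> (j < i)))
          (iota 0 (size lab))) (iota 0 (size lab))].

(** Labels increase along rows and decrease down columns. As [std_le] breaks ties by label, it means
    weak increase along rows and strict increase down columns. *)
Lemma schurE n p : size lab = n.+1 -> labelling ->
  schur la p =
    (\sum_(s <- perms n.+1 | lin_ext n.+1 cell_con s) Qdes n.+1 p (descents s))%R.
Proof.
move=> sz_lab /and4P[uniq_lab /allP in_la /allP all_lab /allP mon].
pose rc (x : cell la) : nat * nat := ((val x).1 : nat, (val x).2 : nat).
have rc_inj : injective rc.
  move=> [[r c] ?] [[r' c'] ?] [/= /val_inj Er /val_inj Ec].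
  by apply/val_inj; rewrite /= Er Ec.
have rc_lab x : rc x \in lab.
  have r_la : ((val x).1 : nat) \in iota 0 (size la) by rewrite mem_iota /=.
  by apply: (allP (all_lab _ r_la)); rewrite mem_iota /= (valP x).
pose g' x : 'I_n.+1 := inord (index (rc x) lab).
have g'E x : g' x = index (rc x) lab :> nat.
  by rewrite inordK // -sz_lab index_mem.
have nth_g' x : nth (0, 0) lab (g' x) = rc x by rewrite g'E nth_index.
have g'_inj : injective g' by move=> x y E; apply/rc_inj; rewrite -!nth_g' E.
have g'_surj i : exists x, g' x == i.
  have := in_la (nth (0, 0) lab i); rewrite mem_nth ?sz_lab // => /(_ isT).
  case Ei: (nth _ _ _) => [r c] /= /and3P[lt_r lt_c lt_rc].
  exists (Sub (Ordinal lt_r, Ordinal lt_c) lt_rc).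
  rewrite -val_eqE /= g'E /rc SubK /= -Ei index_uniq ?sz_lab //.
pose g i := xchoose (g'_surj i).
have gK : cancel g g' by move=> i; apply/eqP/(xchooseP (g'_surj i)).
have g'K : cancel g' g by move=> x; apply/g'_inj/gK.
rewrite -sum_respects /schur.
pose h (t : n.+1.-tuple 'I_p) : {ffun cell la -> 'I_p} :=
  [ffun x => tnth t (g' x)].
pose h' (T : {ffun cell la -> 'I_p}) : n.+1.-tuple 'I_p :=
  mktuple (fun i => T (g i)).
rewrite (reindex h); last first.
  apply: onW_bij; exists h' => [t|T].
    by apply: eq_from_tnth => i; rewrite tnth_mktuple ffunE gK.
  by apply/ffunP => x; rewrite ffunE tnth_mktuple g'K.
apply: eq_big => [t|t _]; last first.
  rewrite [RHS](reindex g'); last by apply: onW_bij; exists g.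
  by apply: eq_bigr => x _; rewrite ffunE.
have conE x y :
    (row_le (g' x) (g' y)
       = ((val x).1 == (val y).1) && ((val x).2 <= (val y).2))
    * (col_lt (g' x) (g' y)
       = ((val x).2 == (val y).2) && ((val x).1 < (val y).1)).
  by rewrite /row_le /col_lt !nth_g' /= !val_eqE.
have monE x y : (row_le (g' x) (g' y) ==> (g' x <= g' y))
             && (col_lt (g' x) (g' y) ==> (g' y < g' x)).
  have mem_g' z : (g' z : nat) \in iota 0 (size lab).
    by rewrite mem_iota sz_lab ltn_ord.
  exact: (allP (mon _ (mem_g' x)) _ (mem_g' y)).
have tE x : tval_at t (g' x) = h t x by rewrite /tval_at inord_val ffunE.
apply/forallP/forallP => [ss i|resp x].
  apply/forallP => j; rewrite -(gK i) -(gK j).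
  have /forallP/(_ (g j)) := ss (g i).
  rewrite -!conE /cell_con /std_le !tE; have := monE (g i) (g j); lia.
apply/forallP => y; have /forallP/(_ (g' y)) := resp (g' x).
by rewrite -!conE /cell_con /std_le !tE; have := monE x y; lia.
Qed.

End Schur.

(** * Schur expansions modulo the 4-cycle relations *)

(* The word s together with the word opposite to it in its 4-cycle. *)
Definition opps k s := nbrs k (head [::] (nbrs k s)).

(** Rows are taken from the bottom one up, so that labels decrease down each column, as [labelling]
    requires. *)
Definition row_reading (la : seq nat) : seq (nat * nat) :=
  flatten [seq [seq (r, c) | c <- iota 0 (nth 0 la r)]
             | r <- rev (iota 0 (size la))].

(** Such an [s] is a standard tableau of shape [la], given by the cells in the order of their
    entries. Its descents are the usual ones: the next entry lies in a lower row. *)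
Definition lin_descents n la :=
  [seq descents s | s <- perms n & lin_ext n (cell_con (row_reading la)) s].

(* For each descent vector D, replacing s and its opposite by the neighbours of
   s, for all listed (k, s), turns the words of descent vector D into the words
   attached to the partitions la, each taken as often as la has standard
   tableaux of descent vector D. *)
Definition schur_certificate n
    (words : seq (seq nat * seq (seq nat)))
    (exchanges : seq (seq bool * seq (nat * seq nat))) : bool :=
  let table := [seq (lin_descents n la.1, la.2) | la <- words] in
  [&& all (fun la => [&& is_partition la.1, size (row_reading la.1) == n
                       & labelling la.1 (row_reading la.1)]) words,
      uniq (unzip1 words), uniq (unzip1 exchanges),
      all (fun s => descents s \in unzip1 exchanges) (perms n) &
      all (fun De =>
        all (fun ks => (ks.1.+2 < n) && (perm_eq ks.2 (iota 0 n))) De.2 &&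
        perm_eq
         ([seq s <- perms n | descents s == De.1]
            ++ flatten [seq nbrs ks.1 ks.2 | ks <- De.2])
         (flatten [seq flatten (nseq (count_mem De.1 t.1) t.2) | t <- table]
            ++ flatten [seq opps ks.1 ks.2 | ks <- De.2])) exchanges].

(** The coefficients of [Qdes D] are compared for each descent vector D. The certificate is an
    identity of multisets of words in which the exchanged words sit on both sides; their sums of [g]
    agree and cancel, so no subtraction leaves the natural numbers. *)
Lemma schur_expansion n p words exchanges (g : seq nat -> nat) :
  schur_certificate n.+1 words exchanges ->
  (forall k s, k.+2 < n.+1 -> s \in perms n.+1 ->
     \sum_(t <- nbrs k s) g t = \sum_(t <- opps k s) g t) ->
  (\sum_(s <- perms n.+1) Qdes n.+1 p (descents s) *+ g s =
   \sum_(la <- words) schur la.1 p *+ (\sum_(s <- la.2) g s)%N)%R.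
Proof.
move=> /and5P[/allP part_words _ uniq_D /allP mem_D /allP checks] g_exch.
have group (s : seq (seq nat)) (F : seq nat -> nat) : {subset s <= perms n.+1} ->
    (\sum_(x <- s) Qdes n.+1 p (descents x) *+ F x =
     \sum_(De <- exchanges) Qdes n.+1 p De.1 *+
        (\sum_(x <- s | descents x == De.1) F x)%N)%R.
  move=> s_perms; rewrite -(big_map fst xpredT (fun D => Qdes n.+1 p D *+
    (\sum_(x <- s | descents x == D) F x)%N)%R).
  under [RHS]eq_bigr do rewrite -GRing.sumrMnr big_mkcond.
  rewrite exchange_big; apply: eq_big_seq => x /s_perms /mem_D D_x /=.
  rewrite -big_mkcond -big_filter.
  under eq_filter do rewrite eq_sym.
  by rewrite filter_pred1_uniq // big_seq1.
rewrite group //.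
transitivity (\sum_(la <- words) \sum_(De <- exchanges) Qdes n.+1 p De.1 *+
    (count_mem De.1 (lin_descents n.+1 la.1) * \sum_(s <- la.2) g s)%N)%R; last first.
  (* On the Schur side the weight is constant over the tableaux of [la], so grouping just counts the
     tableaux with descent vector D. *)
  apply: eq_big_seq => la /part_words/and3P[_ /eqP sz_la lab_la].
  rewrite (schurE _ sz_la lab_la) -[in RHS]GRing.sumrMnl -(big_filter (perms n.+1)).
  apply/esym; apply: etrans (group _ (fun=> \sum_(s <- la.2) g s) _) _ => [s|].
    by rewrite mem_filter => /andP[].
  apply: eq_bigr => De _; congr (_ *+ _)%R.
  by rewrite big_const_seq iter_addn_0 mulnC /lin_descents count_map.
rewrite exchange_big; apply: eq_big_seq => De /checks /andP[/allP ok_De check].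
rewrite GRing.sumrMnr; congr (_ *+ _)%R.
have flattenE (T : Type) (e : seq T) (F : T -> seq (seq nat)) :
    \sum_(t <- flatten [seq F x | x <- e]) g t = \sum_(x <- e) \sum_(t <- F x) g t.
  by rewrite big_flatten big_map.
have := perm_big _ check (op := addn) (x := 0) (P := xpredT) (F := g).
rewrite !big_cat /= !flattenE big_filter big_map /=.
rewrite (eq_big_seq (fun ks => \sum_(t <- opps ks.1 ks.2) g t)) => [/addIn->|];
  last first.
  by move=> ks /ok_De/andP[lt_k perm_s]; apply: g_exch; rewrite // mem_perms.
apply: eq_bigr => la _.
by rewrite big_flatten /= big_nseq iter_addn_0 mulnC.
Qed.
(* The words attached to la count the coefficient of s_la.  They and the
   exchanges are solutions of linear programs. *)
Definition schur_words4 : seq (seq nat * seq (seq nat)) :=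
  [:: ([:: 4],
       [:: [:: 0; 1; 2; 3]]);
      ([:: 3; 1],
       [:: [:: 0; 1; 3; 2];
           [:: 0; 2; 3; 1];
           [:: 1; 2; 3; 0]]);
      ([:: 2; 2],
       [:: [:: 1; 0; 3; 2];
           [:: 2; 3; 0; 1]]);
      ([:: 2; 1; 1],
       [:: [:: 0; 3; 2; 1];
           [:: 1; 3; 2; 0];
           [:: 2; 3; 1; 0]]);
      ([:: 1; 1; 1; 1],
       [:: [:: 3; 2; 1; 0]])].

Definition exchanges4 : seq (seq bool * seq (nat * seq nat)) :=
  [:: ([:: false; false; false], [::]);
      ([:: true; false; false],
       [:: (0, [:: 1; 0; 2; 3]); (0, [:: 1; 0; 3; 2]); (1, [:: 0; 2; 1; 3]);
           (1, [:: 1; 2; 0; 3])]);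
      ([:: false; true; false],
       [:: (1, [:: 0; 2; 1; 3]); (1, [:: 1; 2; 0; 3])]);
      ([:: false; false; true], [::]);
      ([:: true; true; false],
       [:: (0, [:: 2; 0; 3; 1]); (0, [:: 2; 1; 3; 0]); (1, [:: 2; 1; 0; 3]);
           (1, [:: 3; 1; 0; 2])]);
      ([:: true; false; true],
       [:: (0, [:: 2; 0; 3; 1]); (0, [:: 2; 1; 3; 0])]);
      ([:: false; true; true], [::]);
      ([:: true; true; true], [::])].

Definition schur_words5 : seq (seq nat * seq (seq nat)) :=
  [:: ([:: 5],
       [:: [:: 0; 1; 2; 3; 4]]);
      ([:: 4; 1],
       [:: [:: 0; 1; 2; 4; 3];
           [:: 0; 1; 3; 4; 2];
           [:: 0; 2; 3; 4; 1];
           [:: 1; 2; 3; 4; 0]]);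
      ([:: 3; 2],
       [:: [:: 0; 2; 1; 4; 3];
           [:: 0; 3; 4; 1; 2];
           [:: 1; 2; 0; 4; 3];
           [:: 1; 3; 4; 0; 2];
           [:: 2; 3; 4; 0; 1]]);
      ([:: 3; 1; 1],
       [:: [:: 0; 1; 4; 3; 2];
           [:: 0; 2; 4; 3; 1];
           [:: 0; 3; 4; 2; 1];
           [:: 1; 2; 4; 3; 0];
           [:: 1; 3; 4; 2; 0];
           [:: 2; 3; 4; 1; 0]]);
      ([:: 2; 2; 1],
       [:: [:: 1; 0; 4; 3; 2];
           [:: 2; 0; 4; 3; 1];
           [:: 2; 1; 4; 3; 0];
           [:: 3; 4; 0; 2; 1];
           [:: 3; 4; 1; 2; 0]]);
      ([:: 2; 1; 1; 1],
       [:: [:: 0; 4; 3; 2; 1];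
           [:: 1; 4; 3; 2; 0];
           [:: 2; 4; 3; 1; 0];
           [:: 3; 4; 2; 1; 0]]);
      ([:: 1; 1; 1; 1; 1],
       [:: [:: 4; 3; 2; 1; 0]])].

Definition exchanges5 : seq (seq bool * seq (nat * seq nat)) :=
  [:: ([:: false; false; false; false], [::]);
      ([:: true; false; false; false],
       [:: (0, [:: 1; 0; 2; 3; 4]); (0, [:: 1; 0; 3; 2; 4]); (0, [:: 1; 0; 4; 2; 3]);
           (1, [:: 0; 2; 1; 3; 4]); (1, [:: 0; 2; 1; 4; 3]); (1, [:: 1; 2; 0; 3; 4]);
           (1, [:: 1; 2; 0; 4; 3]); (2, [:: 0; 1; 3; 2; 4]); (2, [:: 0; 2; 3; 1; 4]);
           (2, [:: 1; 2; 3; 0; 4])]);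
      ([:: false; true; false; false],
       [:: (0, [:: 1; 0; 2; 4; 3]); (0, [:: 1; 0; 3; 4; 2]); (0, [:: 0; 3; 2; 1; 4]);
           (0, [:: 2; 0; 3; 4; 1]); (0, [:: 1; 3; 2; 0; 4]); (0, [:: 2; 1; 3; 4; 0]);
           (1, [:: 0; 2; 1; 3; 4]); (1, [:: 0; 2; 1; 4; 3]); (1, [:: 1; 2; 0; 3; 4]);
           (1, [:: 1; 2; 0; 4; 3]); (1, [:: 2; 1; 0; 4; 3]); (1, [:: 3; 1; 0; 4; 2]);
           (2, [:: 0; 1; 3; 2; 4]); (2, [:: 0; 2; 3; 1; 4]); (2, [:: 0; 3; 1; 4; 2]);
           (2, [:: 1; 0; 3; 2; 4]); (2, [:: 1; 2; 3; 0; 4]); (2, [:: 1; 3; 0; 4; 2]);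
           (2, [:: 2; 0; 3; 1; 4]); (2, [:: 2; 1; 3; 0; 4]); (2, [:: 2; 3; 0; 4; 1]);
           (2, [:: 3; 0; 2; 1; 4]); (2, [:: 3; 1; 2; 0; 4])]);
      ([:: false; false; true; false],
       [:: (2, [:: 0; 1; 3; 2; 4]); (2, [:: 0; 2; 3; 1; 4]); (2, [:: 1; 2; 3; 0; 4])]);
      ([:: false; false; false; true], [::]);
      ([:: true; true; false; false],
       [:: (0, [:: 2; 0; 3; 1; 4]); (0, [:: 2; 0; 4; 1; 3]); (0, [:: 2; 1; 3; 4; 0]);
           (0, [:: 2; 1; 4; 3; 0]); (0, [:: 3; 0; 4; 1; 2]); (1, [:: 0; 3; 1; 4; 2]);
           (1, [:: 0; 3; 2; 4; 1]); (1, [:: 1; 3; 2; 4; 0]); (1, [:: 2; 1; 0; 3; 4]);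
           (1, [:: 2; 1; 0; 4; 3]); (1, [:: 2; 3; 1; 4; 0]); (1, [:: 3; 1; 0; 2; 4]);
           (1, [:: 3; 1; 0; 4; 2]); (1, [:: 4; 1; 0; 2; 3]); (1, [:: 4; 1; 0; 3; 2]);
           (2, [:: 0; 3; 2; 1; 4]); (2, [:: 0; 4; 2; 1; 3]); (2, [:: 2; 1; 3; 0; 4]);
           (2, [:: 3; 1; 2; 0; 4]); (2, [:: 4; 1; 2; 0; 3])]);
      ([:: true; false; true; false],
       [:: (0, [:: 1; 0; 2; 4; 3]); (0, [:: 1; 0; 3; 4; 2]); (0, [:: 2; 0; 3; 4; 1]);
           (0, [:: 2; 0; 4; 1; 3]); (0, [:: 2; 1; 3; 4; 0]); (0, [:: 2; 1; 4; 0; 3]);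
           (0, [:: 3; 0; 4; 1; 2]); (0, [:: 3; 1; 4; 0; 2]); (0, [:: 3; 2; 4; 0; 1]);
           (1, [:: 0; 3; 1; 4; 2]); (1, [:: 0; 3; 2; 4; 1]); (1, [:: 1; 3; 0; 4; 2]);
           (1, [:: 1; 3; 2; 4; 0]); (1, [:: 2; 1; 0; 4; 3]); (1, [:: 2; 3; 0; 4; 1]);
           (1, [:: 2; 3; 1; 4; 0]); (1, [:: 3; 1; 0; 4; 2]); (2, [:: 0; 4; 2; 1; 3]);
           (2, [:: 1; 0; 3; 2; 4]); (2, [:: 1; 4; 2; 0; 3]); (2, [:: 2; 0; 3; 1; 4]);
           (2, [:: 2; 1; 3; 0; 4]); (2, [:: 2; 4; 1; 0; 3]); (2, [:: 3; 0; 2; 1; 4]);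
           (2, [:: 3; 1; 2; 0; 4]); (2, [:: 3; 4; 1; 0; 2])]);
      ([:: true; false; false; true],
       [:: (0, [:: 1; 0; 2; 4; 3]); (0, [:: 1; 0; 3; 4; 2]); (0, [:: 1; 0; 4; 3; 2]);
           (0, [:: 2; 0; 3; 4; 1]); (0, [:: 2; 0; 4; 3; 1]); (0, [:: 2; 1; 3; 4; 0]);
           (0, [:: 2; 1; 4; 3; 0]); (1, [:: 0; 3; 1; 4; 2]); (1, [:: 0; 3; 2; 4; 1]);
           (1, [:: 1; 3; 0; 4; 2]); (1, [:: 1; 3; 2; 4; 0]); (1, [:: 2; 3; 0; 4; 1]);
           (1, [:: 2; 3; 1; 4; 0])]);
      ([:: false; true; true; false],
       [:: (1, [:: 0; 3; 1; 4; 2]); (1, [:: 0; 3; 2; 4; 1]); (1, [:: 1; 3; 0; 4; 2]);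
           (1, [:: 1; 3; 2; 4; 0]); (1, [:: 2; 3; 0; 4; 1]); (1, [:: 2; 3; 1; 4; 0]);
           (2, [:: 0; 3; 2; 1; 4]); (2, [:: 0; 4; 2; 1; 3]); (2, [:: 1; 3; 2; 0; 4]);
           (2, [:: 1; 4; 2; 0; 3]); (2, [:: 2; 3; 1; 0; 4]); (2, [:: 2; 4; 1; 0; 3]);
           (2, [:: 3; 4; 1; 0; 2])]);
      ([:: false; true; false; true],
       [:: (1, [:: 0; 3; 1; 4; 2]); (1, [:: 0; 3; 2; 4; 1]); (1, [:: 1; 3; 0; 4; 2]);
           (1, [:: 1; 3; 2; 4; 0]); (1, [:: 2; 3; 0; 4; 1]); (1, [:: 2; 3; 1; 4; 0])]);
      ([:: false; false; true; true], [::]);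
      ([:: true; true; true; false],
       [:: (0, [:: 3; 0; 4; 2; 1]); (0, [:: 3; 1; 4; 2; 0]); (0, [:: 3; 2; 4; 1; 0]);
           (1, [:: 3; 2; 0; 4; 1]); (1, [:: 3; 2; 1; 4; 0]); (1, [:: 4; 2; 0; 3; 1]);
           (1, [:: 4; 2; 1; 3; 0]); (2, [:: 3; 2; 1; 0; 4]); (2, [:: 4; 2; 1; 0; 3]);
           (2, [:: 4; 3; 1; 0; 2])]);
      ([:: true; true; false; true],
       [:: (0, [:: 2; 1; 3; 0; 4]); (0, [:: 1; 3; 2; 4; 0]); (0, [:: 2; 1; 4; 0; 3]);
           (0, [:: 1; 4; 2; 3; 0]); (0, [:: 3; 0; 4; 2; 1]); (0, [:: 3; 1; 4; 0; 2]);
           (0, [:: 3; 1; 4; 2; 0]); (0, [:: 3; 2; 4; 0; 1]); (0, [:: 3; 2; 4; 1; 0]);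
           (1, [:: 1; 3; 0; 4; 2]); (1, [:: 2; 3; 0; 4; 1]); (1, [:: 3; 2; 0; 4; 1]);
           (1, [:: 3; 2; 1; 4; 0]); (1, [:: 4; 2; 0; 3; 1]); (1, [:: 4; 2; 1; 3; 0]);
           (2, [:: 1; 3; 2; 0; 4]); (2, [:: 1; 4; 2; 0; 3]); (2, [:: 2; 1; 0; 4; 3]);
           (2, [:: 2; 3; 1; 0; 4]); (2, [:: 2; 4; 1; 0; 3]); (2, [:: 3; 1; 0; 4; 2]);
           (2, [:: 3; 4; 1; 0; 2]); (2, [:: 4; 1; 0; 3; 2])]);
      ([:: true; false; true; true],
       [:: (0, [:: 3; 0; 4; 2; 1]); (0, [:: 3; 1; 4; 2; 0]); (0, [:: 3; 2; 4; 1; 0])]);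
      ([:: false; true; true; true], [::]);
      ([:: true; true; true; true], [::])].

Lemma schur_certificate4 : schur_certificate 4 schur_words4 exchanges4.
Proof. by vm_compute. Qed.

Lemma schur_certificate5 : schur_certificate 5 schur_words5 exchanges5.
Proof. by vm_compute. Qed.

(** * Components of restrictions *)

Lemma uniq_nbrs k s : uniq (nbrs k s).
Proof.
rewrite map_inj_in_uniq => [|t u t_nb u_nb /eqP].
  rewrite /nb3; case: ifP => [|_]; [|case: ifP => //];
    rewrite /= !inE !eqseq_cons; lia.
have sz_tu : size t = size u by rewrite (size_nb3 t_nb) (size_nb3 u_nb).
by rewrite eqseq_cat // eqxx eqseq_cat //= => /andP[/eqP].
Qed.

Lemma nb3_values a b c : a < b < c ->
  [/\ nb3 b a c = [:: [:: b; c; a]; [:: a; c; b]],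
      nb3 b c a = [:: [:: b; a; c]; [:: c; a; b]],
      nb3 a c b = [:: [:: c; a; b]; [:: b; a; c]] &
      nb3 c a b = [:: [:: a; c; b]; [:: b; c; a]]].
Proof.
by move=> abc; split; rewrite /nb3; (case: ifP; [|case: ifP]) => //; lia.
Qed.

Lemma nb3_mixed x y z t : t \in nb3 x y z -> exists a b c, a < b < c /\
  [:: x; y; z] \in [:: [:: b; a; c]; [:: b; c; a]; [:: a; c; b]; [:: c; a; b]].
Proof.
rewrite /nb3; case: ifP => [/orP[] xyz _|_]; last case: ifP => // /orP[] xyz _.
- by exists y, x, z; rewrite xyz !inE eqxx ?orbT.
- by exists z, x, y; rewrite xyz !inE eqxx ?orbT.
- by exists x, z, y; rewrite xyz !inE eqxx ?orbT.
- by exists y, z, x; rewrite xyz !inE eqxx ?orbT.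
Qed.

(** A 4-cycle is the complete bipartite graph K_{2,2}: the neighbours of a vertex have the same
    neighbours, and two steps lead back to the original side. *)
Lemma nb3_exchange x y z t1 t2 t3 : [:: t1; t2; t3] \in nb3 x y z ->
  [/\ forall u1 u2 u3, [:: u1; u2; u3] \in nb3 x y z ->
        perm_eq (nb3 t1 t2 t3) (nb3 u1 u2 u3),
      forall u1 u2 u3, [:: u1; u2; u3] \in nb3 t1 t2 t3 ->
        perm_eq (nb3 u1 u2 u3) (nb3 x y z),
      perm_eq [:: t1; t2; t3] [:: x; y; z] &
      [:: x; y; z] \in nb3 t1 t2 t3].
Proof.
move=> t_nb; have [a [b [c [/nb3_values[E1 E2 E3 E4]]]]] := nb3_mixed t_nb.
have swap (T : eqType) (p q : T) : perm_eq [:: p; q] [:: q; p].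
  by apply/permP => P; rewrite /= !addn0 addnC.
by rewrite !inE => /or4P[] /eqP[Ex Ey Ez]; move: t_nb; rewrite {}Ex {}Ey {}Ez
   ?E1 ?E2 ?E3 ?E4 !inE => /orP[] /eqP[-> -> ->]; rewrite ?E1 ?E2 ?E3 ?E4;
   (split; [move=> u1 u2 u3 | move=> u1 u2 u3 | | by rewrite !inE eqxx ?orbT]);
   first [ by rewrite !inE => /orP[] /eqP[-> -> ->];
              rewrite ?E1 ?E2 ?E3 ?E4 ?perm_refl ?swap
         | by apply/permP => P /=; lia ].
Qed.

Lemma nbrs_catP v x y z w t :
  t \in nbrs (size v) (v ++ x :: y :: z :: w) ->
  exists t1 t2 t3, [:: t1; t2; t3] \in nb3 x y z /\ t = v ++ t1 :: t2 :: t3 :: w.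
Proof.
rewrite nbrs_cat => /mapP[u u_nb ->].
by case: u u_nb (size_nb3 u_nb) => [|t1 [|t2 [|t3 []]]] // u_nb _; exists t1, t2, t3.
Qed.

Section Nbrs.

Variables (k : nat) (s : seq nat).
Hypothesis lt_k : k.+2 < size s.

Let split_s : exists v x y z w, k = size v /\ s = v ++ x :: y :: z :: w.
Proof.
have [x [y [z Es]]] := split3 lt_k; exists (take k s), x, y, z, (drop k.+3 s).
by split; rewrite // size_takel //; lia.
Qed.

Lemma nbrs_perm t : t \in nbrs k s -> perm_eq t s.
Proof.
have [v [x [y [z [w [-> ->]]]]]] := split_s.
case/nbrs_catP => t1 [t2 [t3 [/nb3_exchange[_ _ pt _] ->]]].
by rewrite perm_cat2l (perm_cat2r w [:: t1; t2; t3] [:: x; y; z]).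
Qed.

Lemma nbrs_exchange1 t u : t \in nbrs k s -> u \in nbrs k s ->
  perm_eq (nbrs k t) (nbrs k u).
Proof.
have [v [x [y [z [w [-> ->]]]]]] := split_s.
case/nbrs_catP => t1 [t2 [t3 [/nb3_exchange[tu _ _ _] ->]]].
case/nbrs_catP => u1 [u2 [u3 [/tu tu3 ->]]].
by rewrite !nbrs_cat perm_map.
Qed.

Lemma nbrs_exchange2 t u : t \in nbrs k s -> u \in nbrs k t ->
  perm_eq (nbrs k u) (nbrs k s).
Proof.
have [v [x [y [z [w [-> ->]]]]]] := split_s.
case/nbrs_catP => t1 [t2 [t3 [/nb3_exchange[_ tu _ _] ->]]].
case/nbrs_catP => u1 [u2 [u3 [/tu tu3 ->]]].
by rewrite !nbrs_cat perm_map.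
Qed.

Lemma nbrs_sym t : t \in nbrs k s -> s \in nbrs k t.
Proof.
have [v [x [y [z [w [-> ->]]]]]] := split_s.
by case/nbrs_catP => t1 [t2 [t3 [/nb3_exchange[_ _ _ ?] ->]]]; rewrite mem_nbrs.
Qed.

End Nbrs.

(* A symmetric weight on the edges of the 4-cycle through s: each vertex sum
   is split over the two edges at that vertex. *)
Lemma sum_nbrs_opps k s (e : seq nat -> seq nat -> nat) (g : seq nat -> nat) :
  k.+2 < size s -> (forall t u, e t u = e u t) ->
  (forall t, perm_eq t s -> nbrs k t != [::] ->
     g t = \sum_(u <- nbrs k t) e t u) ->
  \sum_(t <- nbrs k s) g t = \sum_(t <- opps k s) g t.
Proof.
move=> lt_k eC gE; rewrite /opps; case Es: (nbrs k s) => [|t0 ts].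
  (* The default head is the empty word, which has no neighbours: both sums are empty. *)
  by rewrite /nbrs !nth_nil /= !big_nil.
have t0_s : t0 \in nbrs k s by rewrite Es mem_head.
have pt0 := nbrs_perm lt_k t0_s.
have lt_k0 : k.+2 < size t0 by rewrite (perm_size pt0).
have gE' t u : perm_eq t s -> perm_eq (nbrs k t) (nbrs k u) -> nbrs k u != [::] ->
    g t = \sum_(x <- nbrs k u) e t x.
  move=> pt pn nb_u; rewrite gE // ?(perm_big _ pn) //.
  by rewrite -size_eq0 (perm_size pn) size_eq0.
have nb_s : nbrs k s != [::] by rewrite Es.
have nb_t0 : nbrs k t0 != [::] by have := nbrs_sym lt_k t0_s; case: nbrs.
(* Both sums count the total weight of the edges between the two sides of K_{2,2}, namely [nbrs k s]
   and [nbrs k t0]. *)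
rewrite /= -Es (eq_big_seq (fun t => \sum_(u <- nbrs k t0) e t u)) => [|t t_s].
  rewrite exchange_big; apply: eq_big_seq => u u_t0.
  rewrite (gE' u s) ?(nbrs_exchange2 lt_k t0_s) //.
    by apply: eq_bigr => t _; apply: eC.
  exact: perm_trans (nbrs_perm lt_k0 u_t0) pt0.
by apply: gE'; rewrite ?(nbrs_perm lt_k t_s) ?(nbrs_exchange1 lt_k).
Qed.

Section Components.

Variables (n : nat) (V : finType) (G : scgraph n V) (a b : nat) (w : V).
Local Notation C := (component (Res G a b) w).

Lemma component_edge t v u : v \in C -> 1 < t < (b - a).+1 ->
  edge G (t + a - 1) v u -> u \in C.
Proof.
rewrite !inE => wv lt_t vu; apply: connect_trans wv (connect1 _).
have lt_t' : t < (b - a).+1 by case/andP: lt_t.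
by apply/existsP; exists (Ordinal lt_t'); rewrite /= /res_edge lt_t.
Qed.

Lemma component_ind (P : V -> Prop) : P w ->
  (forall t v u, v \in C -> P v -> 1 < t < (b - a).+1 ->
     edge G (t + a - 1) v u -> P u) ->
  forall v, v \in C -> P v.
Proof.
move=> Pw Pedge v; rewrite inE => /connectP[q path_q ->].
have Cw : w \in C by rewrite inE connect0.
(* Only the start of the path is generalized; the base point of the component remains [w]. *)
move: {1 2 3 5}w path_q Pw Cw => y.
elim: q y => //= x q IHq y /andP[/existsP[t /andP[lt_t yx]] xq] Py Cy.
apply: IHq xq _ _; first exact: Pedge Cy Py lt_t yx.
exact: component_edge Cy lt_t yx.
Qed.

End Components.

(** Two degrees are allowed because that of a restriction, [(b - a).+1], equals the size of the
    window only up to a proof. *)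
Lemma eq_fundamentalQ m m' p (S S' : pred nat) : m = m' ->
  (forall j, 0 < j < m -> S j = S' j) ->
  fundamentalQ m p S = fundamentalQ m' p S'.
Proof.
move=> <- eqS; apply: eq_bigl => t; apply: eq_forallb => j.
apply: eq_forallb => k; case: eqP => //= Ek.
by rewrite eqS // -Ek ltn_ord Ek.
Qed.

(** * Counting the words of a component by their window *)

Section Window.

Variables (n N : nat) (W : {set n.-tuple 'I_N}) (G : cgraph n (wvertex W)).
Hypothesis hG : is_D0 G.
Variables (a m : nat).
Hypotheses (a_gt0 : 0 < a) (window_le : a + m <= n).
Variable w : wvertex W.
Local Notation D := (D0_scgraph G).
Local Notation C := (component (Res D a (a + m)) w).

Let pre := take a.-1 (letters w).
Let mid := take m.+1 (drop a.-1 (letters w)).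
Let suf := drop m.+1 (drop a.-1 (letters w)).
(** [f] turns a rank into the letter of that rank in the window of [w]. As it is increasing, [fill]
    preserves all comparisons inside the window, hence descents and neighbours. *)
Let f := nth 0 (sort leq mid).
Let fill s := pre ++ map f s ++ suf.

Let size_pre : size pre = a.-1.
Proof. by rewrite size_takel // (size_letters w); lia. Qed.

Let size_mid : size mid = m.+1.
Proof. by rewrite size_takel // size_drop (size_letters w); lia. Qed.

Let uniq_mid : uniq mid.
Proof. by rewrite take_uniq // drop_uniq // (uniq_letters hG). Qed.

Let f_mono i j : i < m.+1 -> j < m.+1 -> (f i < f j) = (i < j).
Proof.
have sort_f : sorted ltn (sort leq mid).
  by rewrite ltn_sorted_uniq_leq sort_uniq uniq_mid sort_sorted //; exact: leq_total.
have impl k l : l < m.+1 -> k < l -> f k < f l.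
  move=> lt_l lt_kl; apply: (sorted_ltn_nth ltn_trans) => //;
  by rewrite inE size_sort size_mid // (ltn_trans lt_kl).
move=> lt_i lt_j; case: (ltngtP i j) => [/impl->//|/impl lt|->]; last exact: ltnn.
by have := lt lt_i; lia.
Qed.

Let fill_w : exists2 s, s \in perms m.+1 & letters w = fill s.
Proof.
pose S := sort leq mid; exists (map (index^~ S) mid).
  have sz_S : size S = m.+1 by rewrite size_sort.
  rewrite mem_perms; have -> : iota 0 m.+1 = map (index^~ S) S.
    apply: (@eq_from_nth _ 0) => [|i]; first by rewrite size_map size_iota.
    rewrite size_iota => lt_i.
    by rewrite nth_iota // (nth_map 0) ?sz_S // index_uniq ?sz_S // sort_uniq.
  by rewrite perm_map // perm_sym perm_sort.
rewrite /fill -map_comp map_id_in ?cat_take_drop // => i mid_i /=.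
by rewrite /f nth_index // mem_sort.
Qed.

Let mem_lt s x : s \in perms m.+1 -> x \in s -> x < m.+1.
Proof. by rewrite mem_perms => /perm_mem->; rewrite mem_iota. Qed.

Let size_perms s : s \in perms m.+1 -> size s = m.+1.
Proof. by rewrite mem_perms => /perm_size->; rewrite size_iota. Qed.

Let fill_inj : {in perms m.+1 &, injective fill}.
Proof.
move=> s t perm_s perm_t /eqP; rewrite /fill eqseq_cat // eqxx /=.
rewrite eqseq_cat ?size_map ?(size_perms perm_s) ?(size_perms perm_t) //.
case/andP => /eqP E _; apply: (inj_in_map (A := gtn m.+1)) E.
- move=> i j lt_i lt_j Ef; have := f_mono lt_i lt_j; have := f_mono lt_j lt_i.
  by rewrite Ef ltnn; lia.
- by apply/allP => x /(mem_lt perm_s).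
- by apply/allP => x /(mem_lt perm_t).
Qed.

Let nbrs_fill k s : k.+2 < m.+1 -> s \in perms m.+1 ->
  nbrs (a.-1 + k) (fill s) = map fill (nbrs k s).
Proof.
move=> lt_k perm_s; have lt_ks : k.+2 < size s by rewrite size_perms.
have [x [y [z Es]]] := split3 lt_ks.
have sz_v : size (take k s) = k by rewrite size_takel //; lia.
have f_s u v : u \in s -> v \in s -> (f u < f v) = (u < v).
  by move=> /(mem_lt perm_s) lt_u /(mem_lt perm_s); apply: f_mono.
have [xs ys zs] : [/\ x \in s, y \in s & z \in s].
  by rewrite Es !mem_cat !inE !eqxx !orbT.
move: (take k s) (drop k.+3 s) sz_v Es => v v' sz_v Es.
rewrite Es -sz_v nbrs_cat /fill map_cat /= -catA catA.
rewrite -size_pre -(size_map f v) -size_cat nbrs_cat /nb3 !f_s //.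
by case: ifP => _; [|case: ifP => _]; rewrite /= ?map_cat /= -?catA.
Qed.

Let color t : 1 < t < (a + m - a).+1 ->
  [/\ 1 < t + a - 1 < n, (t - 2).+2 < m.+1 & t + a - 1 - 2 = a.-1 + (t - 2)].
Proof. by move=> lt_t; split; lia. Qed.

(** The colors kept by the restriction only permute letters inside the window, so every vertex of
    the component has the prefix, the suffix and the set of window letters of [w]. *)
Let fill_component v : v \in C -> exists2 s, s \in perms m.+1 & letters v = fill s.
Proof.
pose P (x : wvertex W) := exists2 s, s \in perms m.+1 & letters x = fill s.
move: v; apply: (component_ind (P := P)) fill_w _.
move=> t x u _ [s perm_s Ev] /color[_ lt_k Ek].
move/(edge_nbrs hG); rewrite Ev Ek nbrs_fill // => /mapP[s' s'_nb Eu].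
exists s' => //; rewrite mem_perms (perm_trans (nbrs_perm _ s'_nb)) -?mem_perms //.
by rewrite size_perms.
Qed.

Definition mult s := \sum_(v in C | letters v == fill s) 1.

Lemma res_genfunE p :
  res_genfun D a (a + m) w p =
    (\sum_(s <- perms m.+1) Qdes m.+1 p (descents s) *+ mult s)%R.
Proof.
transitivity (\sum_(v in C) \sum_(s <- perms m.+1 | letters v == fill s)
    Qdes m.+1 p (descents s) : {mpoly int[p]})%R.
  apply: eq_bigr => v Cv; have [s perm_s Ev] := fill_component Cv.
  rewrite big_seq_cond (eq_bigl (fun t => (t \in perms m.+1) && (t == s))); last first.
    move=> t; case perm_t: (t \in perms m.+1) => //=.
    by rewrite Ev eq_sym; apply/eqP/eqP => [/fill_inj->|->].
  rewrite -big_seq_cond -big_filter filter_pred1_uniq ?permutations_uniq //.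
  rewrite big_seq1; apply: eq_fundamentalQ => [|[|j] // /andP[_ lt_j]]; first lia.
  have lt_j' : j < (a + m - a).+1.-1 by lia.
  have lt_jm : j.+1 < m.+1 by lia.
  rewrite nth_descents ?size_perms //.
  rewrite [LHS](nth_mktuple _ false (Ordinal lt_j')) /= sgE; last lia.
  rewrite /letter Ev /fill.
  have nth_fill k : k < m.+1 ->
      nth 0 (pre ++ map f s ++ suf) (k + a.-1) = f (nth 0 s k).
    move=> lt_k; rewrite nth_cat size_pre ltnNge leq_addl addnK /=.
    by rewrite nth_cat size_map size_perms // lt_k (nth_map 0) ?size_perms.
  (* The sign number [j.+1] of the restriction is the sign number [j + a] of the graph; it compares
     the entries [j] and [j.+1] of the window, which starts at position [a.-1]. *)
  have -> : j + a = j.+1 + a.-1 by lia.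
  have -> : (j.+1 + a.-1).-1 = j + a.-1 by lia.
  have mem_s k : k < m.+1 -> nth 0 s k < m.+1.
    by move=> lt_k; apply: (mem_lt perm_s); rewrite mem_nth ?size_perms.
  by rewrite !nth_fill ?(ltnW lt_jm) // leqNgt f_mono ?mem_s ?(ltnW lt_jm) // -leqNgt.
rewrite (exchange_big_dep xpredT) //=; apply: eq_bigr => s _.
by rewrite /mult -GRing.sumrMnr.
Qed.

(** The weight of a pair of words is the number of edges between the vertices carrying them. Each
    vertex with a nonempty list of neighbours has exactly one edge of the color, and it stays in the
    component; hence [mult] is the vertex sum of this weight. *)
Lemma mult_exchange k s : k.+2 < m.+1 -> s \in perms m.+1 ->
  \sum_(t <- nbrs k s) mult t = \sum_(t <- opps k s) mult t.
Proof.
move=> lt_k perm_s; have lt_ks : k.+2 < size s by rewrite size_perms.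
pose i := k.+2 + a - 1; have Ei : i - 2 = a.-1 + k by rewrite /i; lia.
have lt_i : 1 < i < n by rewrite /i; lia.
have lt_t : 1 < k.+2 < (a + m - a).+1 by lia.
pose e t u := \sum_(v in C | letters v == fill t)
                \sum_(v' in C | letters v' == fill u) (edge G i v v' : nat).
apply: (sum_nbrs_opps lt_ks (e := e)) => [t u|t perm_t nb_t].
  rewrite /e exchange_big /=; apply: eq_bigr => v _; apply: eq_bigr => v' _.
  by rewrite edge_sym.
have {}perm_t : t \in perms m.+1.
  by rewrite mem_perms (perm_trans perm_t) -?mem_perms.
rewrite /e exchange_big; apply: eq_bigr => v /andP[Cv /eqP Ev].
have nbE : nbrs (i - 2) (letters v) = map fill (nbrs k t).
  by rewrite Ei Ev nbrs_fill.
have [|y [vy y_uniq]] := nbrs_edge hG (x := v) lt_i.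
  by rewrite nbE; case: (nbrs k t) nb_t.
have Cy : y \in C by apply: (component_edge (t := k.+2) (v := v)).
transitivity (\sum_(u <- nbrs k t) (fill u == letters y)).
  rewrite -(big_map fill xpredT (fun l => (l == letters y) : nat)) -nbE.
  rewrite sum1_count_mem || rewrite -big_mkcond sum1_count.
  by rewrite (count_uniq_mem _ (uniq_nbrs _ _)) (edge_nbrs hG).
apply: eq_bigr => u _.
have edgeE v' : edge G i v v' = (v' == y).
  by apply/idP/eqP => [/y_uniq->|->].
under eq_bigr do rewrite edgeE.
case: (fill u =P letters y) => [Eu|neq_u].
  rewrite (bigD1 y) /= ?Cy ?Eu ?eqxx // big1 ?addn0 // => v' /andP[_ /negPf->].
  by [].
rewrite big1 // => v' /andP[_ /eqP Ev']; case: eqP => // Ey.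
by case: neq_u; rewrite -Ev' Ey.
Qed.

End Window.

Lemma D0_LSP n N (W : {set n.-tuple 'I_N}) (G : cgraph n (wvertex W))
    m words exchanges :
  is_D0 G -> schur_certificate m.+1 words exchanges -> LSP (D0_scgraph G) m.+1.
Proof.
move=> hG cert a a_gt0; have -> : a + m.+1 - 1 = a + m by lia.
move=> le_n w; set g := mult G a m w.
have [/allP part_words uniq_words _ _ _] := and5P cert.
exists (unzip1 words).
(* Looking up [la] in the table is written as a sum, which has a single term because the shapes of
   the table are distinct. *)
exists (fun la => \sum_(x <- words | x.1 == la) \sum_(s <- x.2) g s).
split=> [|p].
  by apply/allP => _ /mapP[x /part_words/and3P[part_x _ _] ->].
rewrite (res_genfunE hG a_gt0 le_n).
rewrite (schur_expansion p cert) => [|k s lt_k perm_s]; last first.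
  exact: mult_exchange.
under [RHS]eq_bigr do rewrite -GRing.sumrMnr big_mkcond.
rewrite exchange_big; apply: eq_big_seq => x words_x /=.
rewrite -big_mkcond -(big_filter (unzip1 words)).
under eq_filter do rewrite eq_sym.
by rewrite filter_pred1_uniq ?map_f // big_seq1.
Qed.

(** * Axiom 4'a *)

Section Path.

Variables (n : nat) (V : finType) (G : scgraph n V) (a : nat) (w : V).
Hypotheses (ax1 : axiom1 G) (a_gt0 : 0 < a) (a_le : a.+3 <= n).

Definition signs3 x := [:: sg G x a; sg G x a.+1; sg G x a.+2].

(** Axiom 0 saturates the inner vertices, and equal consecutive signs at [x1] and [x5] forbid a
    further edge there, so the path is the whole component. The result is s_{31} + s_{22} or, for
    [s] true, s_{211} + s_{22}; it does not depend on [a], which lets two windows be compared. *)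
Lemma path5_genfun (s : bool) x1 x2 x3 x4 x5 p :
  edge G a.+1 x1 x2 -> edge G a.+2 x2 x3 -> edge G a.+1 x3 x4 ->
  edge G a.+2 x4 x5 -> w \in [:: x1; x2; x3; x4; x5] ->
  signs3 x1 = [:: ~~ s; s; s] -> signs3 x2 = [:: s; ~~ s; s] ->
  signs3 x3 = [:: ~~ s; s; ~~ s] -> signs3 x4 = [:: s; ~~ s; s] ->
  signs3 x5 = [:: s; s; ~~ s] ->
  res_genfun G a a.+3 w p =
    (\sum_(D <- [:: [:: ~~ s; s; s]; [:: s; ~~ s; s]; [:: ~~ s; s; ~~ s];
                  [:: s; ~~ s; s]; [:: s; s; ~~ s]]) Qdes 4 p D)%R.
Proof.
have [ax0 admE] := ax1.
have [lt1 lt2] : 1 < a.+1 < n /\ 1 < a.+2 < n by lia.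
have sub3 : a.+3 - a = 3 by lia.
have E2 : 2 + a - 1 = a.+1 by lia.
have E3 : 3 + a - 1 = a.+2 by lia.
move=> e12 e23 e34 e45 w_r S1 S2 S3 S4 S5; pose r := [:: x1; x2; x3; x4; x5].
have neq x y : signs3 x != signs3 y -> x != y by apply: contraNneq => ->.
(* Signs separate all pairs of vertices except [x2] and [x4]. If these coincided, axiom 0 would
   identify [x3] with [x5], whose signs differ. *)
have x24 : x2 != x4.
  apply/eqP => Ex; move: e23; rewrite Ex => /ax0/(_ e45) E35.
  by move: S5; rewrite -E35 S3; case: (s).
have uniq_r : uniq r.
  rewrite /= !inE !negb_or x24 !neq ?S1 ?S2 ?S3 ?S4 ?S5 //; by case: (s).
have noedge j x u : 1 < j < n -> sg G x j.-1 = sg G x j -> edge G j x u -> u \in r.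
  move=> lt_j Ex xu; have : admits G j x by apply/existsP; exists u.
  by rewrite admE // Ex eqxx.
have ax0r j x u y : edge G j x u -> edge G j x y -> y \in r -> u \in r.
  by move=> xu /(ax0 _ _ _ _ xu) ->.
have r_all : all (mem r) r by apply/allP.
have /and5P[r1 r2 r3 r4 /andP[r5 _]] := r_all.
have [e21 e32 e43 e54] :
  [/\ edge G a.+1 x2 x1, edge G a.+2 x3 x2, edge G a.+1 x4 x3 & edge G a.+2 x5 x4].
  by split; rewrite edge_sym.
have rI (P : V -> Prop) : P x1 -> P x2 -> P x3 -> P x4 -> P x5 ->
    forall x, x \in r -> P x.
  by move=> ? ? ? ? ? x; rewrite !inE => /or4P[/eqP->|/eqP->|/eqP->|/orP[]/eqP->].
have closed1 : forall x, x \in r -> forall u, edge G a.+1 x u -> u \in r.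
  apply: rI => u.
  - by move/ax0r/(_ e12 r2).
  - by move/ax0r/(_ e21 r1).
  - by move/ax0r/(_ e34 r4).
  - by move/ax0r/(_ e43 r3).
  by apply: (noedge a.+1); [| case: S5 => /= -> ->].
have closed2 : forall x, x \in r -> forall u, edge G a.+2 x u -> u \in r.
  apply: rI => u.
  - by apply: (noedge a.+2); [| case: S1 => /= _ -> ->].
  - by move/ax0r/(_ e23 r3).
  - by move/ax0r/(_ e32 r2).
  - by move/ax0r/(_ e45 r5).
  - by move/ax0r/(_ e54 r4).
pose C := component (Res G a a.+3) w.
have stepC j x u : x \in C -> (1 < j < 4) -> edge G (j + a - 1) x u -> u \in C.
  by move=> Cx lt_j; apply: component_edge Cx _; rewrite sub3.
have step1 x u : edge G a.+1 x u -> x \in C -> u \in C.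
  by move=> xu Cx; apply: (stepC 2) Cx _ _; rewrite // E2.
have step2 x u : edge G a.+2 x u -> x \in C -> u \in C.
  by move=> xu Cx; apply: (stepC 3) Cx _ _; rewrite // E3.
have memC : C =i r.
  move=> x; apply/idP/idP => [|r_x].
    apply: (component_ind (P := fun y => y \in r)).
      exact: w_r.
    move=> [|[|[|[|t]]]] y u _ r_y //; rewrite sub3 ?E2 ?E3 // => _.
      exact: closed1.
    exact: closed2.
  have Cw : w \in C by rewrite inE connect0.
  have C12 : (x1 \in C) = (x2 \in C) by apply/idP/idP; apply: step1.
  have C23 : (x2 \in C) = (x3 \in C) by apply/idP/idP; apply: step2.
  have C34 : (x3 \in C) = (x4 \in C) by apply/idP/idP; apply: step1.
  have C45 : (x4 \in C) = (x5 \in C) by apply/idP/idP; apply: step2.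
  have C1 : x1 \in C.
    apply: (rI (fun y => y \in C -> x1 \in C) _ _ _ _ _ w w_r Cw);
      by rewrite ?C12 ?C23 ?C34 ?C45.
  by apply: (rI (fun y => y \in C) _ _ _ _ _ x r_x);
    rewrite -?C45 -?C34 -?C23 -?C12.
have FE x E : signs3 x = E ->
    fundamentalQ (a.+3 - a).+1 p (sg (Res G a a.+3) x) = Qdes 4 p E.
  move=> <-; apply: eq_fundamentalQ => [|[|j] // /andP[_ lt_j]].
    by rewrite sub3.
  have lt_j' : j < (a.+3 - a).+1.-1 by [].
  rewrite [LHS](nth_mktuple _ false (Ordinal lt_j')) /=.
  by case: j lt_j {lt_j'} => [|[|[|j]]] //; rewrite sub3.
rewrite /res_genfun /genfun_on -/C (eq_bigl _ _ memC) -big_uniq //=.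
rewrite !big_cons !big_nil.
by rewrite (FE _ _ S1) (FE _ _ S2) (FE _ _ S3) (FE _ _ S4) (FE _ _ S5).
Qed.

End Path.

(* The patterns are w = 23154, v = 21534 and w = 43512, v = 45132; up to
   exchanging w and v, axiom 4'a concerns no other edges. *)
Definition flip_shape (w0 w1 w2 w3 w4 v1 v2 v3 : nat) :=
  [&& [&& w2 < w0, w0 < w1, w1 < w4 & w4 < w3]
      || [&& w3 < w4, w4 < w1, w1 < w0 & w0 < w2],
      v1 == w2, v2 == w3 & v3 == w1].

(** A change of both outer signs forces the edge to change both the first and the last of its
    letters, so it joins bac to acb or bca to cab. Then [w0] and [w4] are squeezed between the old
    and new letters next to them, which fixes the pattern of all five. *)
Lemma flip_shapeP w0 w1 w2 w3 w4 v1 v2 v3 :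
  {in [:: w1; w2; w3], forall x, (x != w0) && (x != w4)} ->
  [:: v1; v2; v3] \in nb3 w1 w2 w3 ->
  (w1 <= w0) != (v1 <= w0) -> (w4 <= w3) != (w4 <= v3) ->
  flip_shape w0 w1 w2 w3 w4 v1 v2 v3 || flip_shape w0 v1 v2 v3 w4 w1 w2 w3.
Proof.
move=> neq; have n1 := neq w1; have n2 := neq w2; have n3 := neq w3.
move: n1 n2 n3 {neq}; rewrite !inE !eqxx !orbT /=.
move=> /(_ isT)/andP[n10 n14] /(_ isT)/andP[n20 n24] /(_ isT)/andP[n30 n34].
rewrite /nb3; case: ifP => [/orP[]/andP[c1 c2]|_];
  last case: ifP => [/orP[]/andP[c1 c2]|//].
all: rewrite !inE !eqseq_cons !andbT => /orP[]/and3P[/eqP-> /eqP-> /eqP->].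
all: rewrite /flip_shape !eqxx.
all: case: (ltngtP w1 w0) n10 => // o1 _; case: (ltngtP w2 w0) n20 => // o2 _;
  case: (ltngtP w3 w0) n30 => // o3 _; case: (ltngtP w4 w1) n14 => // o4 _;
  case: (ltngtP w4 w2) n24 => // o5 _; case: (ltngtP w4 w3) n34 => // o6 _ s1 s2;
  try lia.
Qed.

Definition signs4 (x y z t : nat) := [:: y <= x; z <= y; t <= z].

Ltac nb3_cases :=
  rewrite {1}/nb3; case: ifP => [/orP[]/andP[? ?]|_];
  [| |case: ifP => [/orP[]/andP[? ?]|//]];
  rewrite !inE !eqseq_cons !andbT => /orP[]/and3P[/eqP-> /eqP-> /eqP->].

Section Flip.

Variables w0 w1 w2 w3 w4 v1 v2 v3 : nat.
Hypothesis flip : flip_shape w0 w1 w2 w3 w4 v1 v2 v3.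
(** The two patterns are complementary and have opposite signs; stating signs relative to [s] treats
    both together. *)
Let s := w1 <= w0.

Ltac flip_cases :=
  rewrite /s; case/and4P: flip => /orP[]/and4P[? ? ? ?] /eqP ? /eqP ? /eqP ?.

Lemma flip_signs :
  [/\ signs4 w0 w1 w2 w3 = [:: s; ~~ s; s],
      signs4 w0 v1 v2 v3 = [:: ~~ s; s; ~~ s],
      signs4 w1 w2 w3 w4 = [:: ~~ s; s; ~~ s] &
      signs4 v1 v2 v3 w4 = [:: s; ~~ s; s]].
Proof. by flip_cases; split; congr [:: _; _; _]; lia. Qed.

Lemma flip_left_w x y z : [:: x; y; z] \in nb3 w0 w1 w2 ->
  signs4 x y z w3 = [:: ~~ s; s; s].
Proof.
by flip_cases; nb3_cases; try (exfalso; lia); congr [:: _; _; _]; lia.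
Qed.

(* The letters excluded here and in flip_right_w are those of v and of w, which
   are already joined to each other by an edge of that color. *)
Lemma flip_left_v x y z : [:: x; y; z] \in nb3 w0 v1 v2 ->
  signs4 x y z v3 = [:: s; ~~ s; s] /\
  forall y' z' t', [:: y'; z'; t'] \in nb3 y z v3 ->
    ~~ [&& x == w0, y' == v1, z' == v2 & t' == v3] ->
    signs4 x y' z' t' = [:: s; s; ~~ s].
Proof.
flip_cases; nb3_cases; try (exfalso; lia).
all: split; first by congr [:: _; _; _]; lia.
all: by move=> y' z' t'; nb3_cases => neq; try (exfalso; lia);
  congr [:: _; _; _]; lia.
Qed.

Lemma flip_right_w y z t : [:: y; z; t] \in nb3 w2 w3 w4 ->
  signs4 w1 y z t = [:: s; ~~ s; s] /\
  forall x' y' z', [:: x'; y'; z'] \in nb3 w1 y z ->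
    ~~ [&& x' == w1, y' == w2, z' == w3 & t == w4] ->
    signs4 x' y' z' t = [:: ~~ s; s; s].
Proof.
flip_cases; nb3_cases; try (exfalso; lia).
all: split; first by congr [:: _; _; _]; lia.
all: by move=> x' y' z'; nb3_cases => neq; try (exfalso; lia);
  congr [:: _; _; _]; lia.
Qed.

Lemma flip_right_v y z t : [:: y; z; t] \in nb3 v2 v3 w4 ->
  signs4 v1 y z t = [:: s; s; ~~ s].
Proof.
by flip_cases; nb3_cases; try (exfalso; lia); congr [:: _; _; _]; lia.
Qed.

End Flip.

Section Axiom4a.
Variables (n N : nat) (W : {set n.-tuple 'I_N}) (G : cgraph n (wvertex W)).
Hypothesis hG : is_D0 G.
Local Notation D := (D0_scgraph G).

Lemma letter_inj (x y : wvertex W) : (forall k, letter x k = letter y k) -> x = y.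
Proof.
move=> eq_xy; apply: letters_inj; apply: (@eq_from_nth _ 0) => [|k _].
  by rewrite !size_letters.
exact: eq_xy.
Qed.

(** The two conditions of [ZoneOut] say that position [k] is fixed by an edge acting on [q], ...,
    [q.+2] and by one acting on [q.+1], ..., [q.+3]. *)
Variant zone4 q : nat -> Prop :=
  | Zone0 : zone4 q q | Zone1 : zone4 q q.+1 | Zone2 : zone4 q q.+2
  | Zone3 : zone4 q q.+3
  | ZoneOut k of (k < q) || (q.+2 < k) & (k < q.+1) || (q.+3 < k) : zone4 q k.

Lemma zone4P q k : zone4 q k.
Proof.
have [->|[->|[->|[->|k_out]]]] : k = q \/ k = q.+1 \/ k = q.+2 \/ k = q.+3 \/
  ((k < q) || (q.+3 < k)) by lia.
all: by constructor; lia.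
Qed.

Lemma D0_edge i x : 1 < i < n -> sg D x i.-1 != sg D x i -> exists y, edge G i x y.
Proof. by move=> lt_i; rewrite -(admits_sg hG) // => /existsP. Qed.

Let window_edge j x y : edge G j.+2 x y ->
  [:: letter y j; letter y j.+1; letter y j.+2] \in
     nb3 (letter x j) (letter x j.+1) (letter x j.+2) /\
  forall k, (k < j) || (j.+2 < k) -> letter y k = letter x k.
Proof. by move=> /(edge_letters hG); rewrite !subSS subn0. Qed.

Let signs3E q x : q.+3 < n -> signs3 D q.+1 x =
  signs4 (letter x q) (letter x q.+1) (letter x q.+2) (letter x q.+3).
Proof. by move=> lt_q; rewrite /signs3 !sgE //; lia. Qed.

(** The left component is the path [x1], [w], [v], [x4], [x5] and the right one is [y1], [y2], [w],
    [v], [y5]: the edge from [w] to [v] is the second of the former and the third of the latter.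
    Both have the signs required by [path5_genfun] for the same [s]. *)
Lemma flip_genfun q w v u p : q.+4 < n -> edge G q.+3 w v ->
  flip_shape (letter w q) (letter w q.+1) (letter w q.+2) (letter w q.+3)
    (letter w q.+4) (letter v q.+1) (letter v q.+2) (letter v q.+3) ->
  u \in [:: w; v] ->
  res_genfun D q.+1 q.+4 u p = res_genfun D q.+2 q.+4.+1 u p.
Proof.
move=> lt_n wv flip wvu.
have lt_n3 : q.+3 < n by lia.
have [lt1 lt2 lt3] : [/\ 1 < q.+2 < n, 1 < q.+3 < n & 1 < q.+4 < n] by split; lia.
have lt_qn : q.+4 <= n by lia.
have [_ wv_out] := window_edge wv.
have v0 : letter v q = letter w q by rewrite wv_out ?leqnn.
have v4 : letter v q.+4 = letter w q.+4 by rewrite wv_out ?leqnn ?orbT.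
have neq1 : letter w q.+1 != letter v q.+1.
  by move: flip; rewrite /flip_shape; lia.
have neq3 : letter w q.+3 != letter v q.+3.
  by move: flip; rewrite /flip_shape; lia.
have := flip_signs flip; set s := letter w q.+1 <= letter w q => -[].
rewrite -{2}v0 -{2}v4 -!signs3E // => Sw Sv Sw' Sv'.
have s_neq : (s != ~~ s) * (~~ s != s) by split; case: (s).
have [x1 wx1] : exists x, edge G q.+2 w x.
  by apply: D0_edge; case: Sw => // -> -> _; rewrite s_neq.
have [x4 vx4] : exists x, edge G q.+2 v x.
  by apply: D0_edge; case: Sv => // -> -> _; rewrite s_neq.
have [y2 wy2] : exists y, edge G q.+4 w y.
  by apply: D0_edge; case: Sw' => // _ -> ->; rewrite s_neq.
have [y5 vy5] : exists y, edge G q.+4 v y.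
  by apply: D0_edge; case: Sv' => // _ -> ->; rewrite s_neq.
have [x1_nb x1_out] := window_edge wx1; have [x4_nb x4_out] := window_edge vx4.
have [y2_nb y2_out] := window_edge wy2; have [y5_nb y5_out] := window_edge vy5.
have x1_3 := x1_out q.+3; have x4_3 := x4_out q.+3.
have y2_1 := y2_out q.+1; have y5_1 := y5_out q.+1.
rewrite !ltnS leqnn orbT in x1_3 x4_3; rewrite !leqnn /= in y2_1 y5_1.
have {x1_nb} Sx1 := flip_left_w flip x1_nb.
have {y5_nb} Sy5 : signs4 (letter v q.+1) (letter y5 q.+2) (letter y5 q.+3)
    (letter y5 q.+4) = [:: s; s; ~~ s].
  by apply: (flip_right_v flip); rewrite -v4.
rewrite v0 in x4_nb; have [Sx4 Sx5] := flip_left_v flip x4_nb.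
have [Sy2 Sy1] := flip_right_w flip y2_nb.
move: Sx1 Sx4 Sx5 Sy2 Sy1 Sy5.
rewrite -/s; clearbody s; rewrite -x1_3 // -x4_3 // -y2_1 // -y5_1 // -!signs3E //.
move=> Sx1 Sx4 Sx5 Sy2 Sy1 Sy5.
have [x5 x45] : exists x, edge G q.+3 x4 x.
  by apply: D0_edge; case: Sx4 => // _ -> ->; rewrite s_neq.
have [y1 y21] : exists y, edge G q.+3 y2 y.
  by apply: D0_edge; case: Sy2 => // -> -> _; rewrite s_neq.
have [/Sx5 {}Sx5 x5_out] := window_edge x45.
have [/Sy1 {}Sy1 y1_out] := window_edge y21.
have x5_0 : letter x5 q = letter x4 q by rewrite x5_out ?leqnn.
have y1_4 : letter y1 q.+4 = letter y2 q.+4 by rewrite y1_out ?leqnn ?orbT.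
have {}Sx5 : signs3 D q.+1 x5 = [:: s; s; ~~ s].
  rewrite signs3E // x5_0; apply: Sx5.
  apply/negP => /and4P[/eqP E0 /eqP E1 /eqP E2 /eqP E3].
  (* With the excluded letters [x5] would be [v], whose only edge of this color goes to [w]. Then
     [x4] would be [w], but [x4] agrees with [v] at [q.+3], where [w] does not. *)
  have Ex : x5 = v.
    apply: letter_inj => k; case: (zone4P q k) => [||||j out1 out2] //.
    - by rewrite x5_0 E0 v0.
    - by rewrite E1 y5_1.
    - by rewrite E3 x4_3.
    by rewrite x5_out ?x4_out.
  have Ew : x4 = w.
    by apply: (edge_uniq hG (i := q.+3) (x := v)); rewrite edge_sym // -Ex.
  by rewrite Ew in x4_3; rewrite x4_3 // eqxx in neq3.
have {}Sy1 : signs3 D q.+2 y1 = [:: ~~ s; s; s].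
  rewrite signs3E // y1_4; apply: Sy1.
  apply/negP => /and4P[/eqP E1 /eqP E2 /eqP E3 /eqP E4].
  have Ey : y1 = w.
    apply: letter_inj => k; case: (zone4P q.+1 k) => [||||j out1 out2] //.
    - by rewrite E1 y2_1.
    - by rewrite E3 x1_3.
    - by rewrite y1_4 E4.
    by rewrite y1_out ?y2_out.
  have Ev : y2 = v.
    by apply: (edge_uniq hG (i := q.+3) (x := w)); rewrite // edge_sym -Ey.
  by rewrite Ev in y2_1; rewrite y2_1 // eqxx in neq1.
have ax1 := D0_axiom1 hG.
have [x1w vw y2w y12] : [/\ edge G q.+2 x1 w, edge G q.+3 v w, edge G q.+4 y2 w &
    edge G q.+3 y1 y2] by split; rewrite edge_sym.
move: wvu; rewrite !inE => wvu.
rewrite (path5_genfun (s := s) ax1 _ _ p x1w wv vx4 x45) ?inE //; last first.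
  by case/orP: wvu => ->; rewrite ?orbT.
rewrite (path5_genfun (s := s) ax1 _ _ p y12 y2w wv vy5) ?inE //.
by case/orP: wvu => ->; rewrite ?orbT.
Qed.

Lemma D0_axiom4'a : axiom4'a D.
Proof.
move=> i w v lt_i wv _ sg1 sg2 p.
(* [q] is the position, from 0, of the first of the five letters involved; the edge acts on the
   three in the middle. *)
have [q Ei] : exists q, i = q.+4 by exists (i - 4); lia.
have lt_n : q.+4 < n by lia.
have E3 : q.+4 - 3 = q.+1 by lia.
rewrite {i lt_i}Ei in wv sg1 sg2 *.
rewrite E3 /= in wv sg1 sg2 *; rewrite !sgE in sg1 sg2; try lia.
have [wv_nb wv_out] := window_edge wv.
have v0 : letter v q = letter w q by rewrite wv_out ?leqnn.
have v4 : letter v q.+4 = letter w q.+4 by rewrite wv_out ?leqnn ?orbT.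
rewrite /= v0 v4 in sg1 sg2.
have neq : {in [:: letter w q.+1; letter w q.+2; letter w q.+3],
    forall x, (x != letter w q) && (x != letter w q.+4)}.
  have neq0 j k : j <= q.+4 -> k <= q.+4 -> j != k -> letter w j != letter w k.
    by move=> le_j le_k; apply: (letter_neq hG); lia.
  move=> x; rewrite !inE => /or3P[]/eqP->; rewrite !neq0 //; lia.
have /orP[flip|flip] := flip_shapeP neq wv_nb sg1 sg2.
  by apply: flip_genfun wv flip _; rewrite ?inE ?eqxx.
(* Here [v] plays the role of [w] in the pattern; [flip_genfun] applies to the component of either
   end of the edge. *)
rewrite -v0 -v4 in flip.
apply: (flip_genfun (w := v) (v := w)) flip _; last by rewrite !inE eqxx orbT.
  by [].
by rewrite edge_sym.
Qed.

End Axiom4a.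

Theorem theorem4p10 (n N : nat) (W : {set n.-tuple 'I_N})
    (G : cgraph n (wvertex W)) (hG : is_D0 G) :
  [/\ axiom1 (D0_scgraph G), axiom2 (D0_scgraph G), axiom3 (D0_scgraph G),
      axiom4'a (D0_scgraph G) & LSP (D0_scgraph G) 4 /\ LSP (D0_scgraph G) 5] /\
  (Dgraph (D0_scgraph G) <->
     axiom4'b (D0_scgraph G) /\ axiom5 (D0_scgraph G)).
Proof.
have ax1 := D0_axiom1 hG; have ax2 := D0_axiom2 hG; have ax3 := D0_axiom3 hG.
have ax4a := D0_axiom4'a hG.
have lsp4 := D0_LSP hG schur_certificate4.
have lsp5 := D0_LSP hG schur_certificate5.
split; first by [].
by split=> [[_ [[_ ax4b ax5] _]] | [ax4b ax5]].
Qed.
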